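(* Let $(V,\omega)$ be a $2n$-dimensional real symplectic vector space, $L_0,L_1,L_2\in\Lambda(V,\omega)$, and $\psi:[0,T]\to\mathrm{Sp}(V,\omega)$ continuous with $\psi(0)=\mathrm{Id}$. For $t\in[0,T]$ set $\ell_1(t)=\psi(t)L_1$, $\ell_2(t)=\psi(t)L_2$, $\mu_0(t)=\psi(t)^{-1}L_0$. Let $\epsilon_a=L_1\cap L_2+L_2\cap L_0$, $\epsilon_b=L_1\cap L_2+L_2\cap\mu_0(T)$ and $k=\min\{\dim\epsilon_a,\dim\epsilon_b\}$. Then $$\Big|\iota^{\mathrm{CLM}}\big(L_0,\ell_1(t);t\in[0,T]\big)-\iota^{\mathrm{CLM}}\big(L_0,\ell_2(t);t\in[0,T]\big)\Big|\le n-k.$$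
   Context: $\mathrm{Sp}(V,\omega)$ is the group of linear automorphisms of $V$ preserving $\omega$. Let $(V,\omega)$ be a real symplectic vector space of dimension $2n$ and $\Lambda(V,\omega)$ its Lagrangian Grassmannian (the $n$-dimensional subspaces $L$ with $\omega|_{L\times L}=0$). For $L_0\in\Lambda(V,\omega)$ and a continuous path $\ell:[a,b]\to\Lambda(V,\omega)$, $\iota^{\mathrm{CLM}}(L_0,\ell(t);t\in[a,b])\in\mathbb Z$ denotes the Cappell–Lee–Miller Maslov index: the intersection index of $\ell$ with the Maslov cycle $\Sigma(L_0)=\{L\in\Lambda(V,\omega): L\cap L_0\neq\{0\}\}$; it is invariant under homotopies of $\ell$ with fixed endpoints, additive under concatenation of paths, and for $\mathscr C^1$ paths all of whose crossings are regular it is given by $\iota^{\mathrm{CLM}}(L_0,\ell(t);t\in[a,b])=n_+\big(\Gamma(\ell,L_0,a)\big)+\sum_{a<t<b}\operatorname{sgn}\Gamma(\ell,L_0,t)-n_-\big(\Gamma(\ell,L_0,b)\big)$. Here a crossing is an instant $t_0$ with $\ell(t_0)\cap L_0\neq\{0\}$; the crossing form $\Gamma(\ell,L_0,t_0)$ is the quadratic form on $\ell(t_0)\cap L_0$ defined by choosing $W\in\Lambda(V,\omega)$ transversal to $\ell(t_0)$, letting, for $v\in\ell(t_0)$ and $t$ near $t_0$, $w(t)\in W$ be the unique vector with $v+w(t)\in\ell(t)$, and setting $\Gamma(\ell,L_0,t_0)[v]=\frac{d}{dt}\big|_{t=t_0}\omega(v,w(t))$; a crossing is regular if this form is nondegenerate;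 $n_+,n_-$ denote positive and negative inertia indices and $\operatorname{sgn}=n_+-n_-$. *)

(* Defs.v *)
From HB Require Import structures.
From mathcomp Require Import all_boot all_order all_algebra.
From mathcomp Require Import all_classical all_reals all_analysis.
Set Implicit Arguments. Unset Strict Implicit. Unset Printing Implicit Defensive.
Import Order.TTheory GRing.Theory Num.Theory.
Import numFieldNormedType.Exports.
Local Open Scope classical_set_scope.
Local Open Scope ring_scope.

(* Conventions.  V = row vectors 'rV[R]_(n + n); a symplectic form is given by a
   skew-symmetric invertible matrix Om, omega(u,v) = u Om v^T.
   A linear map acts on the right: v |-> v *m A.
   A linear subspace is the row space of a square matrix (mxalgebra).
   A Lagrangian subspace, as a POINT of the Lagrangian Grassmannian, is
   represented canonically by its orthogonal projector (symmetric idempotent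
   matrix), so that the topology / C^1 structure of Lambda(V,omega) is the one
   induced from the matrix space. *)

Section Symp.
Variable R : realType.
Variable n : nat.
Notation m := (n + n)%N.
Variable Om : 'M[R]_m.

Definition sympl_form : Prop := Om^T = - Om /\ Om \in unitmx.

Definition omega (u v : 'rV[R]_m) : R := (u *m Om *m v^T) 0 0.

Definition sympl_map (A : 'M[R]_m) : Prop := A *m Om *m A^T = Om.

Definition lagr (P : 'M[R]_m) : Prop :=
  P^T = P /\ P *m P = P /\ \rank P = n /\
  (forall u v : 'rV[R]_m, (u <= P)%MS -> (v <= P)%MS -> omega u v = 0).

Definition oproj (M : 'M[R]_m) : 'M[R]_m :=
  (row_base M)^T *m invmx (row_base M *m (row_base M)^T) *m row_base M.

Definition lag_path (l : R -> 'M[R]_m) (a b : R) : Prop :=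
  (forall t, a <= t <= b -> lagr (l t)) /\
  {within [set t | a <= t <= b], continuous l}.

Definition crossing (L0 : 'M[R]_m) (l : R -> 'M[R]_m) (t : R) : bool :=
  (l t :&: L0 != (0 : 'M[R]_m))%MS.

(* Crossing form Gamma(l, L0, t0) computed with a Lagrangian W transversal to
   l(t0): for v in l(t0), w(t) in W is the unique vector with v + w(t) in l(t),
   i.e. w(t) = - v * proj_mx W (l t) (projection onto W along l(t)). *)
Definition crossing_form (l : R -> 'M[R]_m) (t0 : R) (W : 'M[R]_m)
  (v : 'rV[R]_m) : R :=
  derive1 (fun t => omega v (- (v *m proj_mx W (l t)))) t0.

Definition posdef_on (q : 'rV[R]_m -> R) (U : 'M[R]_m) : Prop :=
  forall u : 'rV[R]_m, (u <= U)%MS -> u != 0 -> 0 < q u.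

Definition n_plus (q : 'rV[R]_m -> R) (S : 'M[R]_m) : nat :=
  \big[maxn/0%N]_(k < m.+1 |
     `[< exists U : 'M[R]_m, (U <= S)%MS /\ \rank U = k /\ posdef_on q U >]) k.

Definition n_minus (q : 'rV[R]_m -> R) (S : 'M[R]_m) : nat :=
  n_plus (fun v => - q v) S.

Definition sgn_form (q : 'rV[R]_m -> R) (S : 'M[R]_m) : int :=
  (n_plus q S)%:Z - (n_minus q S)%:Z.

Definition nondeg_on (q : 'rV[R]_m -> R) (S : 'M[R]_m) : Prop :=
  forall u : 'rV[R]_m, (u <= S)%MS ->
    (forall v : 'rV[R]_m, (v <= S)%MS -> q (u + v) - q u - q v = 0) -> u = 0.

(* iota L0 l a b stands for iota^CLM(L0, l(t); t in [a,b]).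
   is_CLM iota: iota satisfies the defining properties of the
   Cappell-Lee-Miller index listed in the paper (which determine it uniquely). *)
Definition is_CLM (iota : 'M[R]_m -> (R -> 'M[R]_m) -> R -> R -> int) : Prop :=
  (forall L0 (l0 l1 : R -> 'M[R]_m) (H : R -> R -> 'M[R]_m) a b,
      lagr L0 -> a <= b -> lag_path l0 a b -> lag_path l1 a b ->
      (forall s t, 0 <= s <= 1 -> a <= t <= b -> lagr (H s t)) ->
      {within [set p : R * R | 0 <= p.1 <= 1 /\ a <= p.2 <= b],
         continuous (fun p : R * R => H p.1 p.2)} ->
      (forall t, a <= t <= b -> H 0 t = l0 t /\ H 1 t = l1 t) ->
      (forall s, 0 <= s <= 1 -> H s a = l0 a /\ H s b = l0 b) ->
      iota L0 l0 a b = iota L0 l1 a b) /\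
  (forall L0 (l : R -> 'M[R]_m) a c b,
      lagr L0 -> a <= c -> c <= b -> lag_path l a b ->
      iota L0 l a b = iota L0 l a c + iota L0 l c b) /\
  (forall L0 (l : R -> 'M[R]_m) (Wc : R -> 'M[R]_m) a b (s : seq R),
      lagr L0 -> a < b ->
      (forall t, lagr (l t)) ->
      (forall t, derivable l t 1) -> continuous ('D_1 l) ->
      (forall t, lagr (Wc t) /\ (Wc t :&: l t == (0 : 'M[R]_m))%MS) ->
      (forall t, a <= t <= b -> crossing L0 l t ->
         nondeg_on (crossing_form l t (Wc t)) (l t :&: L0)%MS) ->
      uniq s ->
      (forall t, t \in s <-> (a < t < b /\ crossing L0 l t)) ->
      iota L0 l a b =
        (n_plus (crossing_form l a (Wc a)) (l a :&: L0)%MS)%:Z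
        + \sum_(t <- s) sgn_form (crossing_form l t (Wc t)) (l t :&: L0)%MS
        - (n_minus (crossing_form l b (Wc b)) (l b :&: L0)%MS)%:Z).

End Symp.

(* Main.v *)
Require Import Defs.
From HB Require Import structures.
From mathcomp Require Import all_boot all_order all_algebra.
From mathcomp Require Import all_classical all_reals all_analysis.
From mathcomp Require Import ring lra zify.
Set Implicit Arguments.
Unset Strict Implicit.
Unset Printing Implicit Defensive.
Import Order.TTheory GRing.Theory Num.Theory.
Import numFieldNormedType.Exports.
Local Open Scope classical_set_scope.
Local Open Scope ring_scope.

(** A Lagrangian is represented by a frame: a row-free matrix [X] with
    [X Om X^T = 0]. Choose frames [X] of [L2] and [Y] of [L1] with
    [X Om Y^T = - D] for an orthogonal projector [D] whose kernel corresponds to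
    [L1 :&: L2]. Then all members of the pencil [X + u (Y - X)] are Lagrangian
    frames, and the pencil joins [L2] to [L1] in the negative direction. Moving
    it by [psi] gives a homotopy from [l2] to [l1], so the difference of the two
    indices is the index of the pencil moved by [psi T] minus the index of the
    pencil itself.

    The index of the pencil lies between [\rank (L1 :&: L2 + L2 :&: L0) - n] and
    [0], and likewise for the moved pencil. It crosses [L0] degenerately only
    along [L1 :&: L2 :&: L0]; bending it by a symplectic shear that is trivial
    at both ends makes all crossings regular, with no positive contribution.
    Vectors of [L0] lying on two distinct members of the pencil have
    [D]-orthogonal coordinates, so the negative contributions, together with the
    coordinates of [L1 :&: L2 + L2 :&: L0], are independent in an
    [n]-dimensional space. *)

(** * Gram matrices and orthogonal projectors *)

Definition gram (R : pzRingType) p r s (M : 'M[R]_p)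
    (X : 'M[R]_(r, p)) (Y : 'M[R]_(s, p)) : 'M[R]_(r, s) :=
  X *m M *m Y^T.

Section Gram.
Variables (R : comPzRingType) (p : nat) (M : 'M[R]_p).

Lemma gram_mull q r s (A : 'M[R]_(q, r)) (X : 'M[R]_(r, p)) (Y : 'M[R]_(s, p)) :
  gram M (A *m X) Y = A *m gram M X Y.
Proof. by rewrite /gram !mulmxA. Qed.

Lemma gram_mulr q r s (A : 'M[R]_(q, s)) (X : 'M[R]_(r, p)) (Y : 'M[R]_(s, p)) :
  gram M X (A *m Y) = gram M X Y *m A^T.
Proof. by rewrite /gram trmx_mul mulmxA. Qed.

Lemma gramDl r s (X1 X2 : 'M[R]_(r, p)) (Y : 'M[R]_(s, p)) :
  gram M (X1 + X2) Y = gram M X1 Y + gram M X2 Y.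
Proof. by rewrite /gram !mulmxDl. Qed.

Lemma gramDr r s (X : 'M[R]_(r, p)) (Y1 Y2 : 'M[R]_(s, p)) :
  gram M X (Y1 + Y2) = gram M X Y1 + gram M X Y2.
Proof. by rewrite /gram linearD mulmxDr. Qed.

Lemma gramNl r s (X : 'M[R]_(r, p)) (Y : 'M[R]_(s, p)) :
  gram M (- X) Y = - gram M X Y.
Proof. by rewrite /gram !mulNmx. Qed.

Lemma gramNr r s (X : 'M[R]_(r, p)) (Y : 'M[R]_(s, p)) :
  gram M X (- Y) = - gram M X Y.
Proof. by rewrite /gram linearN mulmxN. Qed.

Lemma gramZl r s a (X : 'M[R]_(r, p)) (Y : 'M[R]_(s, p)) :
  gram M (a *: X) Y = a *: gram M X Y.
Proof. by rewrite /gram -!scalemxAl. Qed.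

Lemma gramZr r s a (X : 'M[R]_(r, p)) (Y : 'M[R]_(s, p)) :
  gram M X (a *: Y) = a *: gram M X Y.
Proof. by rewrite /gram linearZ -scalemxAr. Qed.

Lemma tr_gram r s (X : 'M[R]_(r, p)) (Y : 'M[R]_(s, p)) :
  (gram M X Y)^T = gram M^T Y X.
Proof. by rewrite /gram !trmx_mul trmxK mulmxA. Qed.

End Gram.

Lemma gram_polarization (R : comPzRingType) p (M : 'M[R]_p) (x y : 'rV[R]_p) :
  M^T = M ->
  gram M (x + y) (x + y) 0 0 - gram M x x 0 0 - gram M y y 0 0 =
  gram M x y 0 0 *+ 2.
Proof.
move=> M_sym; have yx : gram M y x 0 0 = gram M x y 0 0.
  by rewrite -[in LHS]M_sym -tr_gram mxE.
have addE (A B : 'M[R]_1) : (A + B) 0 0 = A 0 0 + B 0 0 by rewrite mxE.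
by rewrite gramDl !gramDr !addE yx; ring.
Qed.

Lemma gramC (R : comPzRingType) p r s (M : 'M[R]_p)
    (X : 'M[R]_(r, p)) (Y : 'M[R]_(s, p)) :
  M^T = - M -> gram M Y X = - (gram M X Y)^T.
Proof. by move=> M_skew; rewrite tr_gram M_skew /gram mulmxN mulNmx opprK. Qed.

Lemma gram_isometry (R : comPzRingType) p r s (M A : 'M[R]_p)
    (X : 'M[R]_(r, p)) (Y : 'M[R]_(s, p)) :
  gram M A A = M -> gram M (X *m A) (Y *m A) = gram M X Y.
Proof. by move=> MA; rewrite gram_mull gram_mulr MA mulmxA. Qed.

Section GramOrthogonality.
Variables (F : fieldType) (p : nat) (M : 'M[F]_p).

Lemma gram_eq0 r s (X : 'M[F]_(r, p)) (Y : 'M[F]_(s, p)) :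
  (gram M X Y == 0) = (X <= kermx (M *m Y^T))%MS.
Proof. by rewrite sub_kermx mulmxA. Qed.

Lemma gram_eq0Sl q r s (X : 'M[F]_(q, p)) (Y : 'M[F]_(r, p))
    (Z : 'M[F]_(s, p)) :
  (X <= Y)%MS -> gram M Y Z = 0 -> gram M X Z = 0.
Proof. by move=> /submxP[A ->] YZ; rewrite gram_mull YZ mulmx0. Qed.

Lemma gram_eq0Sr q r s (X : 'M[F]_(q, p)) (Y : 'M[F]_(r, p))
    (Z : 'M[F]_(s, p)) :
  (Y <= Z)%MS -> gram M X Z = 0 -> gram M X Y = 0.
Proof. by move=> /submxP[A ->] XZ; rewrite gram_mulr XZ mul0mx. Qed.

Lemma gram_eq0S q r s t (X : 'M[F]_(q, p)) (Y : 'M[F]_(r, p)) (Z : 'M[F]_(s, p))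
    (T : 'M[F]_(t, p)) :
  (X <= Y)%MS -> (Z <= T)%MS -> gram M Y T = 0 -> gram M X Z = 0.
Proof. by move=> XY ZT /(gram_eq0Sr ZT); exact: gram_eq0Sl. Qed.

End GramOrthogonality.

Section SquaredNorm.
Variables (R : realFieldType) (p : nat).
Implicit Types x : 'rV[R]_p.

Lemma mulmx_tr_ge0 x : 0 <= (x *m x^T) 0 0.
Proof. by rewrite mxE; apply: sumr_ge0 => i _; rewrite mxE -expr2 sqr_ge0. Qed.

Lemma mulmx_tr_eq0 x : (x *m x^T) 0 0 = 0 -> x = 0.
Proof.
rewrite mxE => /eqP; rewrite psumr_eq0 => [/allP x0|i _]; last first.
  by rewrite mxE -expr2 sqr_ge0.
apply/rowP => i; have := x0 i (mem_index_enum i).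
by rewrite !mxE -expr2 sqrf_eq0 => /eqP.
Qed.

Lemma mulmx_tr_unitmx r (X : 'M[R]_(r, p)) : row_free X -> X *m X^T \in unitmx.
Proof.
move=> fX; rewrite -row_free_unit; apply: inj_row_free => x xXX.
apply: (row_free_inj fX); rewrite mul0mx; apply: mulmx_tr_eq0.
by rewrite trmx_mul !mulmxA -(mulmxA x) xXX mul0mx mxE.
Qed.

End SquaredNorm.

Lemma sym_idem_inj (F : fieldType) p (P Q : 'M[F]_p) :
  P^T = P -> P *m P = P -> Q^T = Q -> Q *m Q = Q -> (P :=: Q)%MS -> P = Q.
Proof.
move=> PT PP QT QQ PQ.
have idem_fixes A B : A *m A = A -> (B <= A)%MS -> B *m A = B :> 'M[F]_p.
  by move=> AA /submxP[C ->]; rewrite -mulmxA AA.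
have PQP : P *m Q = P by apply: idem_fixes; rewrite // PQ.
have QPQ : Q *m P = Q by apply: idem_fixes; rewrite // PQ.
by rewrite -PT -PQP trmx_mul PT QT.
Qed.

Section SymIdemGram.
Variables (R : realFieldType) (p : nat) (P : 'M[R]_p).
Hypotheses (P_sym : P^T = P) (P_idem : P *m P = P).

Lemma gram_sym_idem (x : 'rV[R]_p) : gram P x x = x *m P *m (x *m P)^T.
Proof. by rewrite trmx_mul P_sym !mulmxA -(mulmxA x P P) P_idem. Qed.

Lemma gram_sym_idem_ge0 (x : 'rV[R]_p) : 0 <= gram P x x 0 0.
Proof. by rewrite gram_sym_idem mulmx_tr_ge0. Qed.

Lemma gram_sym_idem_eq0 (x : 'rV[R]_p) : gram P x x 0 0 = 0 -> x *m P = 0.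
Proof. by rewrite gram_sym_idem => /mulmx_tr_eq0. Qed.

End SymIdemGram.

Lemma rank_row_base (F : fieldType) m p (A : 'M[F]_(m, p)) r :
  \rank A = r -> exists2 X : 'M[F]_(r, p), row_free X & (X :=: A)%MS.
Proof.
by case: _ /; exists (row_base A); [exact: row_base_free|exact: eq_row_base].
Qed.

(* A projector only when [X] is row free. *)
Definition row_proj (R : realFieldType) r p (X : 'M[R]_(r, p)) : 'M[R]_p :=
  X^T *m invmx (X *m X^T) *m X.

Section RowProjector.
Variables (R : realFieldType) (r p : nat) (X : 'M[R]_(r, p)).
Hypothesis fX : row_free X.

Lemma tr_row_proj : (row_proj X)^T = row_proj X.
Proof. by rewrite /row_proj !trmx_mul trmx_inv trmx_mul !trmxK mulmxA. Qed.

Lemma mul_row_proj : X *m row_proj X = X.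
Proof. by rewrite /row_proj !mulmxA mulmxV ?mul1mx// mulmx_tr_unitmx. Qed.

Lemma row_proj_idem : row_proj X *m row_proj X = row_proj X.
Proof. by rewrite {1}/row_proj -!mulmxA mul_row_proj mulmxA. Qed.

Lemma row_proj_eqmx : (row_proj X :=: X)%MS.
Proof.
apply/eqmxP/andP; split; first exact: submxMl.
by rewrite -{1}mul_row_proj submxMl.
Qed.

Lemma sym_idem_row_proj (P : 'M[R]_p) :
  P^T = P -> P *m P = P -> (P :=: X)%MS -> P = row_proj X.
Proof.
move=> PT PP PX; apply: sym_idem_inj; rewrite ?tr_row_proj ?row_proj_idem//.
exact: eqmx_trans PX (eqmx_sym row_proj_eqmx).
Qed.

End RowProjector.

Section OprojRowProj.
Variables (R : realType) (n : nat) (M : 'M[R]_(n + n)).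

Lemma oproj_eqmx : (oproj M :=: M)%MS.
Proof.
exact: eqmx_trans (row_proj_eqmx (row_base_free M)) (eq_row_base M).
Qed.

Lemma oproj_row_proj r (X : 'M[R]_(r, n + n)) :
  row_free X -> (M :=: X)%MS -> oproj M = row_proj X.
Proof.
move=> fX MX; have fM := row_base_free M; apply: (sym_idem_row_proj fX).
- exact: (tr_row_proj (row_base M)).
- exact: row_proj_idem fM.
- exact: eqmx_trans oproj_eqmx MX.
Qed.

End OprojRowProj.

(** * Lagrangian frames *)

Definition lag_frame (F : fieldType) n (Om : 'M[F]_(n + n))
    (X : 'M[F]_(n, n + n)) : Prop :=
  row_free X /\ gram Om X X = 0.

Section Isotropic.
Variables (F : fieldType) (p : nat) (Om : 'M[F]_p).
Hypothesis Om_unit : Om \in unitmx.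

Lemma isotropic_dual r (E : 'M[F]_(r, p)) :
    2%:R != 0 :> F -> Om^T = - Om -> row_free E -> gram Om E E = 0 ->
  exists2 D : 'M[F]_(r, p), gram Om E D = 1%:M & gram Om D D = 0.
Proof.
move=> two_neq0 Om_skew fE E0; pose G := (pinvmx (E *m Om))^T.
have fEOm : row_free (E *m Om) by rewrite /row_free mxrankMfree ?row_free_unit.
have EG : gram Om E G = 1%:M by rewrite /gram trmxK mulmxVp.
have GE : gram Om G E = - 1%:M by rewrite gramC// EG trmx1.
pose A := 2%:R^-1 *: gram Om G G.
have AA : gram Om G G = A + A.
  by rewrite -scalerDl -mulr2n -(mulr_natl 2^-1) mulfV// scale1r.
have AT : A^T = - A by rewrite /A linearZ/= -scalerN {2}gramC// opprK.
exists (G - A *m E); first by rewrite gramDr gramNr gram_mulr E0 mul0mx subr0.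
rewrite gramDl !gramDr !gramNl !gramNr !gram_mull !gram_mulr E0 EG GE AT AA.
rewrite mul0mx mulmx0 oppr0 subr0 mulmx1 mulNmx mul1mx opprK.
by rewrite addrK subrr.
Qed.

Lemma isometry_unitmx (A : 'M[F]_p) : gram Om A A = Om -> A \in unitmx.
Proof.
by move=> AOm; move: Om_unit; rewrite -AOm !unitmx_mul => /andP[/andP[]].
Qed.

End Isotropic.

Section LagrangianFrames.
Variables (F : fieldType) (n : nat) (Om : 'M[F]_(n + n)).
Hypothesis Om_unit : Om \in unitmx.
Implicit Types X Y : 'M[F]_(n, n + n).

Lemma lag_frame_max X r (V : 'M[F]_(r, n + n)) :
  lag_frame Om X -> gram Om V X = 0 -> (V <= X)%MS.
Proof.
move=> [fX X0] /eqP; rewrite gram_eq0 => /submx_trans; apply.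
move/eqP: X0; rewrite gram_eq0 => /mxrank_leqif_sup <-.
rewrite (eqP fX) mxrank_ker -(mxrank_tr (Om *m _)) trmx_mul trmxK.
by rewrite mxrankMfree ?row_free_unit ?unitmx_tr// (eqP fX) addnK.
Qed.

Lemma lag_frame_eqmx X Y : lag_frame Om X -> (Y :=: X)%MS -> lag_frame Om Y.
Proof.
move=> [fX X0] YX; split; first by rewrite /row_free YX.
by apply: gram_eq0S X0; rewrite YX.
Qed.

Lemma lag_frame_isometry X A :
  gram Om A A = Om -> lag_frame Om X -> lag_frame Om (X *m A).
Proof.
move=> AOm [fX X0]; split; last by rewrite gram_isometry.
by rewrite /row_free mxrankMfree// row_free_unit (isometry_unitmx Om_unit).
Qed.

Lemma lag_frame_transversal X Y :
    lag_frame Om X -> lag_frame Om Y ->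
  (gram Om X Y \in unitmx) = ((Y :&: X)%MS == 0).
Proof.
move=> fX fY; rewrite -row_free_unit; apply/idP/idP => [uXY|/eqP YX].
  apply/rowV0P => v; rewrite sub_capmx => /andP[vY /submxP[x vx]].
  apply/eqP; rewrite vx mulmx_free_eq0 ?fX.1// -(mulmx_free_eq0 _ uXY).
  by rewrite -gram_mull -vx; apply/eqP; exact: gram_eq0Sl vY fY.2.
apply: inj_row_free => x xXY; apply/eqP; rewrite -(mulmx_free_eq0 _ fX.1).
rewrite -submx0 -YX sub_capmx submxMl andbT.
by apply: lag_frame_max fY _; rewrite gram_mull.
Qed.

Lemma lag_frame_complement X :
    2%:R != 0 :> F -> Om^T = - Om -> lag_frame Om X ->
  exists2 Y, lag_frame Om Y & gram Om X Y = 1%:M.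
Proof.
move=> two_neq0 Om_skew [fX X0].
have [Y XY Y0] := isotropic_dual Om_unit two_neq0 Om_skew fX X0.
exists Y => //; split=> //; apply/row_freeP; exists (- (Om *m X^T)).
by rewrite mulmxN mulmxA -/(gram Om Y X) gramC// XY trmx1 opprK.
Qed.

End LagrangianFrames.

Section LagrangianProjectors.
Variables (R : realType) (n : nat) (Om : 'M[R]_(n + n)).
Implicit Types (P : 'M[R]_(n + n)) (X : 'M[R]_(n, n + n)).

Lemma omegaE u v : omega Om u v = gram Om u v 0 0.
Proof. by []. Qed.

Lemma lag_frame_lagr X : lag_frame Om X -> lagr Om (row_proj X).
Proof.
move=> [fX X0]; have PX := row_proj_eqmx fX.
split; first exact: tr_row_proj.
split; first exact: row_proj_idem.
split=> [|u v]; first by rewrite PX; apply/eqP.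
by rewrite !PX => uX vX; rewrite omegaE (gram_eq0S uX vX X0) mxE.
Qed.

Lemma lagr_isotropic P : lagr Om P -> gram Om P P = 0.
Proof.
move=> [_ [_ [_ P0]]]; apply/matrixP => i j; rewrite [RHS]mxE.
rewrite -(P0 (row i P) (row j P)) ?row_sub// /omega -!row_mul tr_row !mxE.
by apply: eq_bigr => k _; rewrite !mxE.
Qed.

Lemma lagr_frame P : lagr Om P -> exists2 X, lag_frame Om X & P = row_proj X.
Proof.
move=> lP; have [P_sym [P_idem [/rank_row_base[X fX XP] _]]] := lP.
exists X; last exact: sym_idem_row_proj fX _ P_sym P_idem (eqmx_sym XP).
by split=> //; apply: gram_eq0S (lagr_isotropic lP); rewrite XP.
Qed.

Lemma lagr_transversal X : sympl_form Om -> lag_frame Om X ->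
  exists W, lagr Om W /\ (W :&: row_proj X == (0 : 'M[R]_(n + n)))%MS.
Proof.
move=> [Om_skew Om_unit] fX.
have two_neq0 : 2%:R != 0 :> R by rewrite pnatr_eq0.
have [Y fY XY] := lag_frame_complement Om_unit two_neq0 Om_skew fX.
exists (row_proj Y); split; first exact: lag_frame_lagr.
apply/eqmx0P/eqP; rewrite -submx0.
rewrite (cap_eqmx (row_proj_eqmx fY.1) (row_proj_eqmx fX.1)) submx0.
by rewrite -(lag_frame_transversal Om_unit fX fY) XY unitmx1.
Qed.

End LagrangianProjectors.

(** * Adapted pairs of frames, pencils and shears *)

(* [D] is an orthogonal projector whose kernel consists of the coordinates, the
   same in [X] and in [Y], of the vectors common to both row spaces. *)
Record adapted (F : fieldType) n (Om : 'M[F]_(n + n))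
    (X Y : 'M[F]_(n, n + n)) (D : 'M[F]_n) : Prop := Adapted {
  adapted_source : lag_frame Om X;
  adapted_target : lag_frame Om Y;
  adapted_sym : D^T = D;
  adapted_idem : D *m D = D;
  adapted_gram : gram Om X Y = - D;
  adapted_coker : (1%:M - D) *m X = (1%:M - D) *m Y }.

Definition pencil (R : pzRingType) m p (X Y : 'M[R]_(m, p)) (u : R) :
    'M[R]_(m, p) :=
  X + u *: (Y - X).

Section Pencil.
Variables (R : pzRingType) (m p : nat) (X Y : 'M[R]_(m, p)).

Lemma pencil0 : pencil X Y 0 = X.
Proof. by rewrite /pencil scale0r addr0. Qed.

Lemma pencil1 : pencil X Y 1 = Y.
Proof. by rewrite /pencil scale1r addrC subrK. Qed.

Lemma pencil_const u : pencil X X u = X.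
Proof. by rewrite /pencil subrr scaler0 addr0. Qed.

End Pencil.

Lemma pencil_mulr (R : comPzRingType) m p q (X Y : 'M[R]_(m, p))
    (A : 'M[R]_(p, q)) u :
  pencil (X *m A) (Y *m A) u = pencil X Y u *m A.
Proof. by rewrite /pencil mulmxDl -scalemxAl mulmxBl. Qed.

Lemma mulmx_pencil (R : comPzRingType) m p q (A : 'M[R]_(q, m))
    (X Y : 'M[R]_(m, p)) u :
  A *m pencil X Y u = pencil (A *m X) (A *m Y) u.
Proof. by rewrite /pencil mulmxDr -scalemxAr mulmxBr. Qed.

Lemma gram_normal_form (F : fieldType) r p (M : 'M[F]_p) (X Y : 'M[F]_(r, p)) :
  exists A B : 'M[F]_r, [/\ A \in unitmx, B \in unitmx &
    gram M (A *m X) (B *m Y) = pid_mx (\rank (gram M X Y))].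
Proof.
set G := gram M X Y.
exists (invmx (col_ebase G)), (invmx (row_ebase G))^T; split.
- by rewrite unitmx_inv col_ebase_unit.
- by rewrite unitmx_tr unitmx_inv row_ebase_unit.
rewrite gram_mull gram_mulr trmxK -/G -{2}(mulmx_ebase G).
by rewrite !mulmxA mulVmx ?col_ebase_unit// mul1mx mulmxK ?row_ebase_unit.
Qed.

Section AdaptedExistence.
Variables (F : fieldType) (n : nat) (Om : 'M[F]_(n + n)).
Hypotheses (Om_skew : Om^T = - Om) (Om_unit : Om \in unitmx).

Lemma adapted_of_idem_gram (X Z : 'M[F]_(n, n + n)) (D : 'M[F]_n) :
    lag_frame Om X -> lag_frame Om Z -> D^T = D -> D *m D = D ->
    gram Om X Z = D ->
  exists2 Y, adapted Om X Y D & (Y :=: Z)%MS.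
Proof.
move=> fX fZ DT DD XZ; pose Y := (1%:M - D) *m X - D *m Z.
have D'D : (1%:M - D) *m D = 0 by rewrite mulmxBl mul1mx DD subrr.
have XY : gram Om X Y = - D.
  by rewrite gramDr gramNr !gram_mulr fX.2 XZ DT mul0mx sub0r DD.
have XYcoker : (1%:M - D) *m X = (1%:M - D) *m Y.
  rewrite /Y mulmxBr !mulmxA D'D mul0mx subr0.
  by rewrite [(1%:M - D) *m (1%:M - D)]mulmxBr mulmx1 D'D subr0.
have YZ : (Y <= Z)%MS.
  apply: (lag_frame_max Om_unit fZ).
  by rewrite gramDl gramNl !gram_mull XZ D'D fZ.2 mulmx0 subr0.
have freeY : row_free Y.
  apply: inj_row_free => x xY; apply: (row_free_inj fX.1).
  have xD : x *m D = 0.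
    rewrite -DT -[D]opprK -XY linearN /= -gramC// -gram_mull xY.
    by rewrite /gram !mul0mx.
  move/(congr1 (mulmx x)): XYcoker.
  by rewrite !mulmxA mulmxBr mulmx1 xD subr0 xY mul0mx.
have YZe : (Y :=: Z)%MS.
  apply/eqmxP/andP; split=> //; have [_ <-] := mxrank_leqif_sup YZ.
  by rewrite (eqP freeY) (eqP fZ.1).
by exists Y => //; split=> //; apply: lag_frame_eqmx fZ YZe.
Qed.

Lemma adapted_exists X0 Y0 : lag_frame Om X0 -> lag_frame Om Y0 ->
  exists X Y D, [/\ adapted Om X Y D, (X :=: X0)%MS & (Y :=: Y0)%MS].
Proof.
move=> fX0 fY0; have [A [B [uA uB XZ]]] := gram_normal_form Om X0 Y0.
have eqX : (A *m X0 :=: X0)%MS by apply: eqmxMfull; rewrite row_full_unit.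
have eqZ : (B *m Y0 :=: Y0)%MS by apply: eqmxMfull; rewrite row_full_unit.
have fX := lag_frame_eqmx fX0 eqX; have fZ := lag_frame_eqmx fY0 eqZ.
have [||Y aXY eqY] := adapted_of_idem_gram fX fZ _ _ XZ.
- by rewrite tr_pid_mx.
- by rewrite pid_mx_id// rank_leq_row.
exists (A *m X0), Y, (pid_mx (\rank (gram Om X0 Y0))); split=> //.
exact: eqmx_trans eqY eqZ.
Qed.

Lemma adapted_refl X : lag_frame Om X -> adapted Om X X 0.
Proof.
by move=> fX; split; rewrite ?trmx0 ?mul0mx ?oppr0//; case: fX.
Qed.

End AdaptedExistence.

Section AdaptedPencil.
Variables (F : fieldType) (n : nat) (Om : 'M[F]_(n + n)).
Hypotheses (Om_skew : Om^T = - Om) (Om_unit : Om \in unitmx).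
Variables (X Y : 'M[F]_(n, n + n)) (D : 'M[F]_n).
Hypothesis aXY : adapted Om X Y D.

Lemma adapted_gramC : gram Om Y X = D.
Proof.
by rewrite gramC// (adapted_gram aXY) linearN/= opprK (adapted_sym aXY).
Qed.

Lemma adapted_isometry A : gram Om A A = Om -> adapted Om (X *m A) (Y *m A) D.
Proof.
case: aXY => fX fY DT DD XY XYcoker AOm; split=> //.
- exact: lag_frame_isometry.
- exact: lag_frame_isometry.
- by rewrite gram_isometry.
- by rewrite !mulmxA XYcoker.
Qed.

Lemma adapted_ker r (x : 'M[F]_(r, n)) : x *m D = 0 -> x *m X = x *m Y.
Proof.
move=> xD; move/(congr1 (mulmx x)): (adapted_coker aXY).
by rewrite !mulmxA mulmxBr mulmx1 xD subr0.
Qed.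

Lemma adapted_ker_pencil r (x : 'M[F]_(r, n)) u :
  x *m D = 0 -> x *m pencil X Y u = x *m X.
Proof. by move=> /adapted_ker xX; rewrite mulmx_pencil xX pencil_const. Qed.

Lemma adapted_sub_target r (x : 'M[F]_(r, n)) : (x *m X <= Y)%MS -> x *m D = 0.
Proof.
move=> xY; rewrite -[D]opprK -(adapted_gram aXY) mulmxN -gram_mull.
by rewrite (gram_eq0Sl xY (adapted_target aXY).2) oppr0.
Qed.

Lemma adapted_sub_source r (x : 'M[F]_(r, n)) : (x *m Y <= X)%MS -> x *m D = 0.
Proof.
move=> xX; rewrite -adapted_gramC -gram_mull.
exact: gram_eq0Sl xX (adapted_source aXY).2.
Qed.

Lemma gram_pencil u v : gram Om (pencil X Y u) (pencil X Y v) = (u - v) *: D.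
Proof.
have [[_ X0] [_ Y0] _ _ XY _] := aXY.
rewrite /pencil !gramDl !gramDr !gramZl !gramZr !gramDl !gramDr !gramNl !gramNr.
rewrite X0 Y0 XY adapted_gramC; apply/matrixP => i j; rewrite !mxE; ring.
Qed.

Lemma pencil_lag_frame u : lag_frame Om (pencil X Y u).
Proof.
split; last by rewrite gram_pencil subrr scale0r.
apply: inj_row_free => x xP; apply: (row_free_inj (adapted_source aXY).1).
rewrite mul0mx -(adapted_ker_pencil u) ?xP//.
have <- : gram Om (pencil X Y u) (pencil X Y (u - 1)) = D.
  by rewrite gram_pencil opprB addrC subrK scale1r.
by rewrite -gram_mull xP /gram !mul0mx.
Qed.

End AdaptedPencil.

Definition shear (R : pzRingType) r p (Om : 'M[R]_p) (G : 'M[R]_(r, p))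
    (a : R) : 'M[R]_p :=
  1%:M + a *: (Om *m G^T *m G).

Section Shear.
Variables (R : comPzRingType) (r p : nat) (Om : 'M[R]_p) (G : 'M[R]_(r, p)).

Lemma shear0 : shear Om G 0 = 1%:M.
Proof. by rewrite /shear scale0r addr0. Qed.

Lemma mulmx_shear s (V : 'M[R]_(s, p)) a :
  V *m shear Om G a = V + a *: (gram Om V G *m G).
Proof. by rewrite /shear /gram mulmxDr mulmx1 -scalemxAr !mulmxA. Qed.

Hypotheses (Om_skew : Om^T = - Om) (G0 : gram Om G G = 0).

Lemma gram_shear s t (V : 'M[R]_(s, p)) (W : 'M[R]_(t, p)) a b :
  gram Om (V *m shear Om G a) (W *m shear Om G b) =
  gram Om V W - (a - b) *: (gram Om V G *m (gram Om W G)^T).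
Proof.
rewrite !mulmx_shear !gramDl !gramDr !gramZl !gramZr !gram_mull !gram_mulr.
rewrite (gramC W G Om_skew) G0 mul0mx mulmx0 !scaler0 addr0 mulmxN scalerN.
by rewrite scalerBl opprB addrA.
Qed.

Lemma shear_isometry a : gram Om (shear Om G a) (shear Om G a) = Om.
Proof.
rewrite -[shear Om G a]mul1mx gram_shear subrr scale0r subr0.
by rewrite /gram trmx1 mulmx1 mul1mx.
Qed.

End Shear.

(** * Orthogonal sums of anisotropic subspaces *)

Definition anisotropic (F : fieldType) n q (D : 'M[F]_n) (A : 'M[F]_(q, n)) :
    Prop :=
  forall x : 'rV[F]_n, (x <= A)%MS -> gram D x x = 0 -> x = 0.

Lemma mxrank_anisotropic_sum (F : fieldType) n (D : 'M[F]_n) (I : eqType)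
    (s : seq I) (A : I -> 'M[F]_n) q (B : 'M[F]_(q, n)) :
    uniq s -> {in s, forall i, anisotropic D (A i)} ->
    {in s &, forall i j, i != j -> gram D (A i) (A j) = 0} ->
    {in s, forall i, gram D B (A i) = 0} ->
  \rank (\sum_(i <- s) A i + B)%MS = (\sum_(i <- s) \rank (A i) + \rank B)%N.
Proof.
elim: s => [|i s IH] /=; first by rewrite !big_nil adds0mx.
move=> /andP[i_s s_uniq] A_aniso A_orth AB_orth.
rewrite !big_cons -addsmxA mxrank_disjoint_sum ?IH ?addnA//.
- by move=> j js; apply: A_aniso; rewrite inE js orbT.
- by move=> j k js ks; apply: A_orth; rewrite inE ?js ?ks orbT.
- by move=> j js; apply: AB_orth; rewrite inE js orbT.
have i_is : i \in i :: s := mem_head i s.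
have orth : gram D (\sum_(j <- s) A j + B)%MS (A i) = 0.
  apply/eqP; rewrite gram_eq0 addsmx_sub -!gram_eq0 AB_orth// eqxx andbT.
  rewrite gram_eq0 big_seq.
  apply: (big_ind (fun S : 'M[F]_n => S <= kermx (D *m (A i)^T))%MS).
  - exact: sub0mx.
  - by move=> S T SK TK; rewrite addsmx_sub SK.
  - move=> j js; rewrite -gram_eq0 A_orth// ?inE ?js ?orbT//.
    by apply: contraNneq i_s => <-.
apply/eqP/rowV0P => v; rewrite sub_capmx => /andP[vA vS].
by apply: (A_aniso _ i_is _ vA); apply: gram_eq0S vS vA orth.
Qed.

(** * Crossings of a bent pencil *)

Definition bent_pencil (R : pzRingType) r m p (Om : 'M[R]_p)
    (X Y : 'M[R]_(m, p)) (G : 'M[R]_(r, p)) (u : R) : 'M[R]_(m, p) :=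
  pencil X Y u *m shear Om G (u ^+ 2 - u).

Section BentPencil.
Variables (F : fieldType) (n r : nat) (Om : 'M[F]_(n + n)).
Hypotheses (Om_skew : Om^T = - Om) (Om_unit : Om \in unitmx).
Variables (X Y : 'M[F]_(n, n + n)) (D : 'M[F]_n) (G : 'M[F]_(r, n + n)).

Local Notation bent := (bent_pencil Om X Y G).

Lemma bent_pencil0 : bent 0 = X.
Proof. by rewrite /bent_pencil expr0n subrr shear0 mulmx1 pencil0. Qed.

Lemma bent_pencil1 : bent 1 = Y.
Proof. by rewrite /bent_pencil expr1n subrr shear0 mulmx1 pencil1. Qed.

Hypotheses (aXY : adapted Om X Y D) (G0 : gram Om G G = 0).

Lemma bent_lag_frame u : lag_frame Om (bent u).
Proof.
apply: lag_frame_isometry => //; first exact: shear_isometry.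
exact: pencil_lag_frame aXY u.
Qed.

Definition bend (u : F) : 'M[F]_(n, r) := gram Om (pencil X Y u) G.

Lemma mulmx_bent s (x : 'M[F]_(s, n)) u :
  x *m bent u = x *m pencil X Y u + (u ^+ 2 - u) *: (x *m bend u *m G).
Proof. by rewrite /bent_pencil mulmxA mulmx_shear gram_mull. Qed.

Lemma gram_bent u v :
  gram Om (bent u) (bent v) =
  (u - v) *: (D - (u + v - 1) *: (bend u *m (bend v)^T)).
Proof.
rewrite /bent_pencil gram_shear// (gram_pencil Om_skew aXY) scalerBr scalerA.
by congr (_ - _ *: _); ring.
Qed.

(* By [gram_bent], minus the derivative of [gram Om (bent u) (bent v)] with
   respect to [v] at [v = u], that is, the crossing form in the coordinates
   of [bent u]. *)
Definition bent_form (u : F) : 'M[F]_n :=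
  (2 * u - 1) *: (bend u *m (bend u)^T) - D.

Lemma tr_bent_form u : (bent_form u)^T = bent_form u.
Proof.
by rewrite linearB linearZ/= trmx_mul trmxK (adapted_sym aXY).
Qed.

Lemma gram_bent_form s t (x : 'M[F]_(s, n)) (y : 'M[F]_(t, n)) u :
  gram (bent_form u) x y =
  (2 * u - 1) *: (x *m bend u *m (y *m bend u)^T) - gram D x y.
Proof.
rewrite /gram /bent_form mulmxBr mulmxBl (trmx_mul y) -scalemxAr -scalemxAl.
by rewrite !mulmxA.
Qed.

End BentPencil.

Section BentCrossings.
Variables (R : realFieldType) (n r : nat) (Om : 'M[R]_(n + n)).
Hypothesis Om_skew : Om^T = - Om.
Variables (X Y : 'M[R]_(n, n + n)) (D : 'M[R]_n).
Hypothesis aXY : adapted Om X Y D.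
Variable L : 'M[R]_(n + n).
Hypothesis L_isotropic : gram Om L L = 0.
Variables (E G : 'M[R]_(r, n + n)).
Hypotheses (eqE : (E :=: X :&: Y :&: L)%MS) (EG : gram Om E G = 1%:M).
Hypothesis G0 : gram Om G G = 0.

Local Notation bent := (bent_pencil Om X Y G).
Local Notation bend := (bend Om X Y G).
Local Notation bent_form := (bent_form Om X Y D G).

Let D_ge0 (x : 'rV[R]_n) : 0 <= gram D x x 0 0.
Proof.
by apply: gram_sym_idem_ge0; [exact: adapted_sym aXY|exact: adapted_idem aXY].
Qed.

Let D_eq0 (x : 'rV[R]_n) : gram D x x 0 0 = 0 -> x *m D = 0.
Proof.
by apply: gram_sym_idem_eq0; [exact: adapted_sym aXY|exact: adapted_idem aXY].
Qed.

Let EX : (E <= X)%MS. Proof. by rewrite eqE -capmxA capmxSl. Qed.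

Let EY : (E <= Y)%MS.
Proof. by rewrite eqE (submx_trans (capmxSl _ _))// capmxSr. Qed.

Let EL : (E <= L)%MS. Proof. by rewrite eqE capmxSr. Qed.

Lemma gram_pencil_common u : gram Om (pencil X Y u) E = 0.
Proof.
have /submxP[e Ee] := EX.
have eD : e *m D = 0 by apply: (adapted_sub_target aXY); rewrite -Ee.
rewrite Ee -(adapted_ker_pencil aXY u eD) gram_mulr.
by rewrite (pencil_lag_frame Om_skew aXY u).2 mul0mx.
Qed.

(* [E] lies in [L] and in every member of the pencil, so pairing it with a
   vector of [L] lying in a bent member isolates the bending term. *)
Lemma mul_bend_eq0 q (x : 'M[R]_(q, n)) u :
  0 < u < 1 -> (x *m bent u <= L)%MS -> x *m bend u = 0.
Proof.
move=> /andP[u0 u1] xL.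
have GE : gram Om G E = - 1%:M by rewrite gramC// EG trmx1.
move/eqP: (gram_eq0S xL EL L_isotropic).
rewrite mulmx_bent gramDl gramZl !gram_mull gram_pencil_common GE mulmx0 add0r.
rewrite mulmxN mulmx1 scaler_eq0 oppr_eq0; case/orP => [|/eqP//].
by rewrite expr2 -[X in _ - X]mulr1 -mulrBr mulf_eq0 subr_eq0 gt_eqF// lt_eqF.
Qed.

Lemma bent_crossing_eq0 (x : 'rV[R]_n) u :
  (x *m bent u <= L)%MS -> x *m D = 0 -> x *m bend u = 0 -> x = 0.
Proof.
move=> xL xD xG; have xX := adapted_ker_pencil aXY u xD.
have xB : x *m bent u = x *m X.
  by rewrite mulmx_bent xX xG mul0mx scaler0 addr0.
have /submxP[e xE] : (x *m X <= E)%MS.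
  by rewrite eqE !sub_capmx submxMl -{2}xB xL (adapted_ker aXY xD) submxMl.
have e0 : e = 0.
  by rewrite -[e]mulmx1 -EG -gram_mull -xE -xX gram_mull.
by apply: (row_free_inj (adapted_source aXY).1); rewrite xE e0 !mul0mx.
Qed.

Lemma bent_crossings_orthogonal p q (x : 'M[R]_(p, n)) (y : 'M[R]_(q, n)) u v :
    0 <= u <= 1 -> 0 <= v <= 1 -> u != v ->
    (x *m bent u <= L)%MS -> (y *m bent v <= L)%MS ->
  gram D x y = 0.
Proof.
move=> u01 v01 uv xL yL.
have bend0 : (u + v - 1) *: (x *m bend u *m (y *m bend v)^T) = 0.
  have [u_in|u_end] := boolP (0 < u < 1).
    by rewrite (mul_bend_eq0 u_in xL) mul0mx scaler0.
  have [v_in|v_end] := boolP (0 < v < 1).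
    by rewrite (mul_bend_eq0 v_in yL) trmx0 mulmx0 scaler0.
  suff -> : u + v - 1 = 0 by rewrite scale0r.
  by move: uv u_end v_end; rewrite neq_lt !negb_and -!leNgt; lra.
move/eqP: (gram_eq0S xL yL L_isotropic).
rewrite gram_mull gram_mulr (gram_bent Om_skew aXY G0) -scalemxAl -scalemxAr.
rewrite scaler_eq0 subr_eq0 (negbTE uv) /=.
rewrite mulmxBl mulmxBr -scalemxAl -scalemxAr.
move: bend0; rewrite trmx_mul !mulmxA => ->.
by rewrite subr0 => /eqP.
Qed.

Lemma bent_form_lt0 (x : 'rV[R]_n) u :
    0 <= u < 1 -> (x *m bent u <= L)%MS -> x != 0 ->
  gram (bent_form u) x x 0 0 < 0.
Proof.
move=> /andP[u0 u1] xL; apply: contra_neqT; rewrite -leNgt gram_bent_form.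
set k := x *m bend u; rewrite mxE [X in X + _]mxE [X in _ + X]mxE => form_ge0.
have [k_ge0 D_x_ge0] := (mulmx_tr_ge0 k, D_ge0 x).
have [u_gt0|u_le0] := ltP 0 u.
  have k0 : k = 0 by apply: mul_bend_eq0 xL; rewrite u_gt0.
  apply: (bent_crossing_eq0 xL _ k0); apply: D_eq0; move: form_ge0.
  by rewrite k0 mul0mx [X in _ * X]mxE; lra.
have u_eq0 : u = 0 by lra.
move: form_ge0; rewrite u_eq0 => form_ge0.
apply: (bent_crossing_eq0 xL); first by apply: D_eq0; lra.
by apply: mulmx_tr_eq0; rewrite -/k; lra.
Qed.

Lemma bent_form_nondegenerate (x : 'rV[R]_n) u :
    0 <= u <= 1 -> (x *m bent u <= L)%MS ->
    (forall y : 'rV[R]_n, (y *m bent u <= L)%MS ->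
       gram (bent_form u) x y = 0) ->
  x = 0.
Proof.
move=> /andP[u0 u1] xL x_radical.
have [u_lt1|u_ge1] := ltP u 1.
  apply/eqP; apply: contraT => /(bent_form_lt0 _ xL); rewrite u0 u_lt1.
  by rewrite x_radical// mxE ltxx => /(_ isT).
have u_eq1 : u = 1 by lra.
rewrite {}u_eq1 bent_pencil1 in xL x_radical; set k := x *m bend 1.
have k0 : k = 0.
  have /submxP[y kE] : (k *m E <= Y)%MS by rewrite mulmx_sub.
  have yD : y *m D = 0.
    by apply: (adapted_sub_source Om_skew aXY); rewrite -kE mulmx_sub.
  have yk : y *m bend 1 = k.
    by rewrite -gram_mull pencil1 -kE gram_mull EG mulmx1.
  apply: mulmx_tr_eq0; have := x_radical y.
  rewrite -kE mulmx_sub// gram_bent_form yk => /(_ isT).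
  have -> : gram D x y = 0.
    by rewrite /gram -mulmxA -(adapted_sym aXY) -trmx_mul yD trmx0 mulmx0.
  by rewrite mulr1 [_ - 1]addrK scale1r subr0 => ->; rewrite mxE.
apply: (bent_crossing_eq0 _ _ k0); first by rewrite bent_pencil1.
have := x_radical x xL; rewrite gram_bent_form -/k k0 mul0mx scaler0 sub0r.
by move/eqP; rewrite oppr_eq0 => /eqP xDx; apply: D_eq0; rewrite xDx mxE.
Qed.

Lemma bent_form_lt0_anisotropic q (A : 'M[R]_(q, n)) u :
    0 < u <= 1 -> (A *m bent u <= L)%MS ->
    (forall x : 'rV[R]_n, (x <= A)%MS -> x != 0 ->
       gram (bent_form u) x x 0 0 < 0) ->
  anisotropic D A.
Proof.
move=> /andP[u0 u1] AL A_neg x xA xDx.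
apply/eqP; apply: contraT => /(A_neg _ xA).
rewrite gram_bent_form xDx subr0; set k := x *m bend u; rewrite mxE.
have [u_lt1|u_ge1] := ltP u 1.
  have -> : k = 0.
    by apply: mul_bend_eq0; rewrite ?u0// (submx_trans (submxMr _ xA)).
  by rewrite mul0mx mxE mulr0 ltxx.
by rewrite ltNge mulr_ge0 ?mulmx_tr_ge0//; lra.
Qed.

Lemma bent_crossings_rank (s : seq R) (A : R -> 'M[R]_n) :
    uniq s -> {in s, forall u, 0 < u <= 1} ->
    {in s, forall u, (A u *m bent u <= L)%MS} ->
    {in s, forall u, anisotropic D (A u)} ->
  (\sum_(u <- s) \rank (A u) + \rank (Y :&: X + X :&: L)%MS <= n)%N.
Proof.
move=> s_uniq s01 AL A_aniso; set S := (_ + _)%MS.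
have SX : S *m pinvmx X *m X = S.
  by rewrite mulmxKpV// addsmx_sub capmxSr capmxSl.
have A_orth u v : u \in s -> v \in s -> u != v -> gram D (A u) (A v) = 0.
  move=> us vs uv; apply: (bent_crossings_orthogonal _ _ uv); rewrite ?AL//.
    by have /andP[/ltW-> ->] := s01 _ us.
  by have /andP[/ltW-> ->] := s01 _ vs.
have SA_orth u : u \in s -> gram D (S *m pinvmx X) (A u) = 0.
  move=> us; have /andP[u0 u1] := s01 _ us.
  apply/eqP; rewrite gram_eq0 addsmxMr addsmx_sub -!gram_eq0.
  apply/andP; split; apply/eqP.
    suff YX_D : (Y :&: X)%MS *m pinvmx X *m D = 0 by rewrite /gram YX_D mul0mx.
    by apply: (adapted_sub_target aXY); rewrite mulmxKpV ?capmxSl ?capmxSr.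
  apply: (@bent_crossings_orthogonal _ _ _ _ 0 u); last exact: AL.
  - by rewrite lexx ler01.
  - by rewrite ltW.
  - by rewrite lt_eqF.
  - by rewrite bent_pencil0 mulmxKpV ?capmxSl ?capmxSr.
apply: leq_trans (rank_leq_col (\sum_(u <- s) A u + S *m pinvmx X)%MS).
rewrite (mxrank_anisotropic_sum s_uniq A_aniso A_orth SA_orth) leq_add2l -{1}SX.
exact: mxrankM_maxl.
Qed.

End BentCrossings.

(** * Limits and derivatives of matrix-valued maps *)

Section MatrixLimits.
Variables (R : realFieldType) (T : Type) (F : set_system T).
Context {FF : Filter F}.

Lemma cvg_mxP p q (M : T -> 'M[R]_(p, q)) (M0 : 'M[R]_(p, q)) :
  M x @[x --> F] --> M0 <->
  forall i j, (M x i j : R) @[x --> F] --> (M0 i j : R).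
Proof.
split=> [MM0 i j|MM0].
  exact: (cvg_comp _ _ MM0 (@coord_continuous _ _ _ i j M0)).
apply/cvgrPdist_le => e e0; near=> x.
rewrite /Num.Def.normr /= mx_normrE (bigmax_le _ (ltW e0))//= => i _.
rewrite !mxE; move: i; near: x; apply: filter_forall => -[i j] /=.
by move/cvgrPdist_le : (MM0 i j); apply.
Unshelve. all: by end_near. Qed.

Lemma cvg_mulmx p q r (A : T -> 'M[R]_(p, q)) (A0 : 'M[R]_(p, q))
    (B : T -> 'M[R]_(q, r)) (B0 : 'M[R]_(q, r)) :
  A x @[x --> F] --> A0 -> B x @[x --> F] --> B0 ->
  A x *m B x @[x --> F] --> A0 *m B0.
Proof.
move=> /cvg_mxP AA0 /cvg_mxP BB0; apply/cvg_mxP => i j.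
rewrite mxE; under eq_fun do rewrite mxE.
apply: cvg_big => [|k _]; first exact: add_continuous.
exact: cvgM.
Qed.

Lemma cvg_trmx p q (A : T -> 'M[R]_(p, q)) (A0 : 'M[R]_(p, q)) :
  A x @[x --> F] --> A0 -> (A x)^T @[x --> F] --> A0^T.
Proof.
move=> /cvg_mxP AA0; apply/cvg_mxP => i j.
by rewrite mxE; under eq_fun do rewrite mxE; exact: AA0.
Qed.

Lemma cvg_gram p r s (M : 'M[R]_p) (X : T -> 'M[R]_(r, p)) (X0 : 'M[R]_(r, p))
    (Y : T -> 'M[R]_(s, p)) (Y0 : 'M[R]_(s, p)) :
  X x @[x --> F] --> X0 -> Y x @[x --> F] --> Y0 ->
  gram M (X x) (Y x) @[x --> F] --> gram M X0 Y0.
Proof.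
move=> XX0 YY0; apply: cvg_mulmx; last exact: cvg_trmx.
by apply: cvg_mulmx => //; exact: cvg_cst.
Qed.

Lemma cvg_det p (A : T -> 'M[R]_p) (A0 : 'M[R]_p) :
  A x @[x --> F] --> A0 -> \det (A x) @[x --> F] --> \det A0.
Proof.
move=> /cvg_mxP AA0; rewrite /determinant.
apply: cvg_big => [|s _]; first exact: add_continuous.
apply: cvgM; first exact: cvg_cst.
by apply: cvg_big => [|i _]; [exact: mul_continuous|exact: AA0].
Qed.

Lemma cvg_adj p (A : T -> 'M[R]_p) (A0 : 'M[R]_p) :
  A x @[x --> F] --> A0 -> \adj (A x) @[x --> F] --> \adj A0.
Proof.
move=> /cvg_mxP AA0; apply/cvg_mxP => i j.
rewrite mxE; under eq_fun do rewrite mxE.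
apply: cvgM; first exact: cvg_cst.
apply: cvg_det; apply/cvg_mxP => k l.
by rewrite !mxE; under eq_fun do rewrite !mxE; exact: AA0.
Qed.

Lemma near_unitmx p (A : T -> 'M[R]_p) (A0 : 'M[R]_p) :
  A0 \in unitmx -> A x @[x --> F] --> A0 -> \forall x \near F, A x \in unitmx.
Proof.
rewrite unitmxE unitfE => detA0 /cvg_det/cvgr_neq0/(_ detA0).
by apply: filterS => x; rewrite unitmxE unitfE.
Qed.

Lemma cvg_invmx p (A : T -> 'M[R]_p) (A0 : 'M[R]_p) :
  A0 \in unitmx -> A x @[x --> F] --> A0 ->
  invmx (A x) @[x --> F] --> invmx A0.
Proof.
move=> uA0 AA0.
have adj_cvg : (\det (A x))^-1 *: \adj (A x) @[x --> F] --> invmx A0.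
  rewrite /invmx uA0; apply: cvgZ; last exact: cvg_adj.
  by apply: cvgV; [rewrite -unitfE -unitmxE|exact: cvg_det].
apply: cvg_trans adj_cvg; apply: near_eq_cvg.
by near do rewrite /invmx ifT//; exact: near_unitmx AA0.
Unshelve. all: by end_near. Qed.

Lemma cvg_row_proj p q (X : T -> 'M[R]_(p, q)) (X0 : 'M[R]_(p, q)) :
  row_free X0 ->
  X x @[x --> F] --> X0 -> row_proj (X x) @[x --> F] --> row_proj X0.
Proof.
move=> fX0 XX0; apply: cvg_mulmx => //; apply: cvg_mulmx; first exact: cvg_trmx.
apply: cvg_invmx; first exact: mulmx_tr_unitmx.
by apply: cvg_mulmx => //; exact: cvg_trmx.
Qed.

Lemma cvg_pencil p q (X Y : 'M[R]_(p, q)) (u : T -> R) (u0 : R) :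
  u x @[x --> F] --> u0 -> pencil X Y (u x) @[x --> F] --> pencil X Y u0.
Proof. by move=> uu0; apply: cvgD; [exact: cvg_cst|exact: cvgZr_tmp]. Qed.

Lemma cvg_shear r p (Om : 'M[R]_p) (G : 'M[R]_(r, p)) (u : T -> R) (u0 : R) :
  u x @[x --> F] --> u0 -> shear Om G (u x) @[x --> F] --> shear Om G u0.
Proof. by move=> uu0; apply: cvgD; [exact: cvg_cst|exact: cvgZr_tmp]. Qed.

End MatrixLimits.

Section Caratheodory.
Variables (R : realFieldType) (V : normedModType R).
Implicit Types (f g : R -> V) (t : R).

Lemma caratheodory_is_derive f g t :
  (forall s, f s = f t + (s - t) *: g s) -> {for t, continuous g} ->
  is_derive t 1 f (g t).
Proof.
move=> fE /continuous_withinNshiftx gt.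
have quot : h^-1 *: ((f \o shift t) (h *: 1) - f t) @[h --> 0^'] --> g t.
  apply: cvg_trans gt; apply: near_eq_cvg; near=> h => /=.
  rewrite [f (_ + t)]fE addrK addrAC subrr add0r [h%:A]mulr1 scalerA.
  rewrite mulVf ?scale1r//.
  by near: h; exact: nbhs_dnbhs_neq.
by apply: DeriveDef; [apply/cvg_ex; exists (g t)|exact: cvg_lim].
Unshelve. all: by end_near. Qed.

Lemma is_derive_caratheodory f df t : is_derive t 1 f df ->
  exists g, [/\ g t = df, {for t, continuous g} &
    forall s, f s = f t + (s - t) *: g s].
Proof.
case=> dft <-.
exists (fun s => if s == t then 'D_1 f t else (s - t)^-1 *: (f s - f t)).
split; first by rewrite eqxx.
  apply/continuous_withinNshiftx; rewrite eqxx; apply: cvg_trans dft.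
  apply: near_eq_cvg; near=> h => /=.
  rewrite -subr_eq0 addrK ifF ?[h%:A]mulr1//.
  by apply/negbTE; near: h; exact: nbhs_dnbhs_neq.
move=> s; have [->|st] := eqVneq; first by rewrite subrr scale0r addr0.
by rewrite scalerA mulfV ?scale1r ?subr_eq0// addrC subrK.
Unshelve. all: by end_near. Qed.

End Caratheodory.

Section MatrixDerivatives.
Variable R : realFieldType.
Implicit Types t : R.

Lemma is_derive_mulmx p q r (A : R -> 'M[R]_(p, q)) (B : R -> 'M[R]_(q, r))
    (dA : 'M[R]_(p, q)) (dB : 'M[R]_(q, r)) t :
  is_derive t 1 A dA -> is_derive t 1 B dB ->
  is_derive t 1 (fun s => A s *m B s) (dA *m B t + A t *m dB).
Proof.
move=> dAt dBt; have Bt : {for t, continuous B}.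
  by apply/differentiable_continuous/derivable1_diffP; exact: ex_derive.
have [a [<- a_t AE]] := is_derive_caratheodory dAt.
have [b [<- b_t BE]] := is_derive_caratheodory dBt.
apply: (caratheodory_is_derive (g := fun s => a s *m B s + A t *m b s)) => [s|].
  rewrite {1}AE mulmxDl {1}BE mulmxDr -scalemxAl -scalemxAr -addrA -scalerDr.
  by rewrite [X in _ *: X]addrC.
by apply: cvgD; apply: cvg_mulmx => //; exact: cvg_cst.
Qed.

Lemma is_derive_trmx p q (A : R -> 'M[R]_(p, q)) (dA : 'M[R]_(p, q)) t :
  is_derive t 1 A dA -> is_derive t 1 (fun s => (A s)^T) dA^T.
Proof.
move=> /is_derive_caratheodory[a [<- a_t AE]].
apply: (caratheodory_is_derive (g := fun s => (a s)^T)) => [s|].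
  by rewrite AE linearD linearZ.
exact: cvg_trmx.
Qed.

Lemma is_derive_invmx p (A : R -> 'M[R]_p) (dA : 'M[R]_p) t :
  (forall s, A s \in unitmx) -> is_derive t 1 A dA ->
  is_derive t 1 (fun s => invmx (A s)) (- (invmx (A t) *m dA *m invmx (A t))).
Proof.
move=> uA dAt; have At : {for t, continuous A}.
  by apply/differentiable_continuous/derivable1_diffP; exact: ex_derive.
have [a [<- a_t AE]] := is_derive_caratheodory dAt.
apply: (caratheodory_is_derive
  (g := fun s => - (invmx (A s) *m a s *m invmx (A t)))) => [s|].
  have aE : (s - t) *: a s = A s - A t by rewrite [A s]AE addrAC subrr add0r.
  rewrite scalerN scalemxAl scalemxAr aE mulmxBr mulmxBl mulVmx// mul1mx.
  by rewrite mulmxK// opprB addrC subrK.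
apply: cvgN; apply: cvg_mulmx; last exact: cvg_cst.
by apply: cvg_mulmx => //; exact: cvg_invmx.
Qed.

End MatrixDerivatives.

Definition contdiff (R : realFieldType) (V : normedModType R) (f : R -> V) :
    Prop :=
  exists2 df, (forall t : R, is_derive t 1 f (df t)) & continuous df.

Section ContDiff.
Variable R : realFieldType.

Lemma contdiff_derive (V : normedModType R) (f : R -> V) :
  contdiff f -> (forall t, derivable f t 1) /\ continuous ('D_1 f).
Proof.
move=> [df fdf cdf]; split=> [t|]; first by have [] := fdf t.
suff -> : 'D_1 f = df by [].
by apply/funext => t; exact: (@derive_val _ _ _ _ _ _ _ (fdf t)).
Qed.

Lemma contdiff_continuous (V : normedModType R) (f : R -> V) :
  contdiff f -> continuous f.
Proof.
move=> [df fdf _] t; apply/differentiable_continuous/derivable1_diffP.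
by have [] := fdf t.
Qed.

Lemma contdiff_mulmx p q r (A : R -> 'M[R]_(p, q)) (B : R -> 'M[R]_(q, r)) :
  contdiff A -> contdiff B -> contdiff (fun t => A t *m B t).
Proof.
move=> cA cB.
have [cA0 cB0] := (contdiff_continuous cA, contdiff_continuous cB).
case: cA cB => [dA AdA cdA] [dB BdB cdB].
exists (fun t => dA t *m B t + A t *m dB t) => t; first exact: is_derive_mulmx.
by apply: cvgD; apply: cvg_mulmx; [exact: cdA|exact: cB0|exact: cA0|exact: cdB].
Qed.

Lemma contdiff_trmx p q (A : R -> 'M[R]_(p, q)) :
  contdiff A -> contdiff (fun t => (A t)^T).
Proof.
case=> dA AdA cdA; exists (fun t => (dA t)^T) => t; first exact: is_derive_trmx.
by apply: cvg_trmx; exact: cdA.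
Qed.

Lemma contdiff_invmx p (A : R -> 'M[R]_p) :
  (forall t, A t \in unitmx) -> contdiff A -> contdiff (fun t => invmx (A t)).
Proof.
move=> uA cA; have cA0 := contdiff_continuous cA; case: cA => dA AdA cdA.
exists (fun t => - (invmx (A t) *m dA t *m invmx (A t))) => t.
  exact: is_derive_invmx.
have cV : invmx (A s) @[s --> t] --> invmx (A t).
  by apply: cvg_invmx (uA t) _; exact: cA0.
by apply: cvgN; apply: cvg_mulmx => //; apply: cvg_mulmx => //; exact: cdA.
Qed.

Lemma contdiff_row_proj p q (X : R -> 'M[R]_(p, q)) :
  (forall t, row_free (X t)) -> contdiff X ->
  contdiff (fun t => row_proj (X t)).
Proof.
move=> fX cX; have cXT := contdiff_trmx cX.
apply: contdiff_mulmx => //; apply: contdiff_mulmx => //; apply: contdiff_invmx.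
  by move=> t; exact: mulmx_tr_unitmx.
exact: contdiff_mulmx.
Qed.

Lemma contdiff_horner_affine p q (A B : 'M[R]_(p, q)) (f : {poly R}) :
  contdiff (fun t => A + f.[t] *: B).
Proof.
exists (fun t => f^`().[t] *: B) => t; last first.
  by apply: cvgZr_tmp; exact: continuous_horner.
have [g [<- g_t fE]] := is_derive_caratheodory (is_derive_poly f t).
apply: (caratheodory_is_derive (g := fun s => g s *: B)) => [s|].
  by rewrite [in LHS]fE scalerDl addrA -scalerA.
exact: cvgZr_tmp.
Qed.

End ContDiff.

Lemma contdiff_bent_pencil (R : realFieldType) r m p (Om : 'M[R]_p)
    (X Y : 'M[R]_(m, p)) (G : 'M[R]_(r, p)) a :
  contdiff (fun t => bent_pencil Om X Y G (t - a)).
Proof.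
pose u := 'X - a%:P.
have uE t : u.[t] = t - a by rewrite !hornerE.
have qE t : (u ^+ 2 - u).[t] = (t - a) ^+ 2 - (t - a) by rewrite !hornerE.
apply: contdiff_mulmx.
  have := contdiff_horner_affine X (Y - X) u.
  by under eq_fun do rewrite uE.
have := contdiff_horner_affine 1%:M (Om *m G^T *m G) (u ^+ 2 - u).
by under eq_fun do rewrite qE.
Qed.

(** * Crossing forms *)

Section CrossingForm.
Variables (R : realType) (n : nat) (Om : 'M[R]_(n + n)).
Hypothesis Om_unit : Om \in unitmx.

Lemma crossing_form0 l t W : crossing_form Om l t W 0 = 0.
Proof.
rewrite /crossing_form; under eq_fun do rewrite omegaE /gram !mul0mx mxE.
exact: derive1_cst.
Qed.

(* Pairing with [W] kills the component of [x *m X] along [W] and thereby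
   determines its component along [Z]. *)
Lemma omega_proj_frame (X Z W : 'M[R]_(n, n + n)) (x : 'rV[R]_n) :
    lag_frame Om X -> lag_frame Om Z -> lag_frame Om W ->
    gram Om Z W \in unitmx ->
  omega Om (x *m X) (- (x *m X *m proj_mx (row_proj W) (row_proj Z))) =
  gram Om (x *m X) (x *m gram Om X W *m invmx (gram Om Z W) *m Z) 0 0.
Proof.
move=> fX fZ fW uZW; set v := x *m X; set w := v *m _.
have [eqW eqZ] := (row_proj_eqmx fW.1, row_proj_eqmx fZ.1).
have WZ0 : (row_proj W :&: row_proj Z)%MS = 0.
  apply/eqP; rewrite -submx0 (cap_eqmx eqW eqZ).
  by move: uZW; rewrite (lag_frame_transversal Om_unit fZ fW) => /eqP->.
have v_WZ : (v <= row_proj W + row_proj Z)%MS.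
  apply: submx_full; rewrite /row_full mxrank_disjoint_sum// eqW eqZ.
  by rewrite (eqP fW.1) (eqP fZ.1).
have /submxP[y vwE] : (v - w <= Z)%MS by rewrite -eqZ proj_mx_compl_sub.
have wW : gram Om w W = 0.
  by apply: gram_eq0Sl fW.2; rewrite -eqW proj_mx_sub.
have vv : gram Om v v = 0 by rewrite gram_mull gram_mulr fX.2 mul0mx mulmx0.
rewrite omegaE -gram_mull.
have -> : gram Om v W = y *m gram Om Z W.
  by rewrite -gram_mull -vwE gramDl gramNl wW subr0.
by rewrite mulmxK// -vwE gramDr vv add0r.
Qed.

Lemma crossing_form_frame (X : R -> 'M[R]_(n, n + n)) (Q : R -> 'M[R]_n) W t x :
    (forall s, lag_frame Om (X s)) -> {for t, continuous X} ->
    (forall s, gram Om (X t) (X s) = (s - t) *: Q s) -> {for t, continuous Q} ->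
    lagr Om W -> (W :&: row_proj (X t) == (0 : 'M[R]_(n + n)))%MS ->
  crossing_form Om (fun s => row_proj (X s)) t W (x *m X t) =
  gram (Q t) x x 0 0.
Proof.
move=> fX Xt XQ Qt /lagr_frame[Z fZ ->] ZX0.
have XZ_unit : gram Om (X t) Z \in unitmx.
  rewrite (lag_frame_transversal Om_unit (fX t) fZ) -submx0.
  rewrite -(cap_eqmx (row_proj_eqmx fZ.1) (row_proj_eqmx (fX t).1)).
  by case/andP: ZX0.
have XZ_cvg : gram Om (X s) Z @[s --> t] --> gram Om (X t) Z.
  by apply: cvg_gram => //; exact: cvg_cst.
pose y s := x *m gram Om (X t) Z *m invmx (gram Om (X s) Z).
pose c s := gram (Q s) x (y s) 0 0.
have c_cvg : {for t, continuous c}.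
  have : x *m Q s *m (y s)^T @[s --> t] --> x *m Q t *m (y t)^T.
    apply: cvg_mulmx; first by apply: cvg_mulmx => //; exact: cvg_cst.
    apply: cvg_trmx; apply: cvg_mulmx; first exact: cvg_cst.
    exact: cvg_invmx.
  by move=> /cvg_mxP/(_ 0 0).
have <- : c t = gram (Q t) x x 0 0 by rewrite /c /y mulmxK.
rewrite /crossing_form derive1E.
suff : is_derive t (1 : R) (fun s => omega Om (x *m X t)
    (- (x *m X t *m proj_mx (row_proj Z) (row_proj (X s))))) (c t).
  by move=> dc; exact: (@derive_val _ _ _ _ _ _ _ dc).
apply: (@near_eq_is_derive _ _ _ (fun s => (s - t) *: c s)); last first.
  by apply: caratheodory_is_derive => // s; rewrite subrr scale0r add0r.
near=> s; rewrite omega_proj_frame//; last first.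
  by near: s; exact: near_unitmx XZ_cvg.
by rewrite -/(y s) gram_mull gram_mulr XQ -scalemxAl -scalemxAr mxE mulmxA.
Unshelve. all: by end_near. Qed.

End CrossingForm.

(** * Inertia indices *)

Section Inertia.
Variables (R : realType) (n : nat).
Implicit Types (q : 'rV[R]_(n + n) -> R) (S U : 'M[R]_(n + n)).

Lemma n_plus_witness q S :
  exists U, [/\ (U <= S)%MS, \rank U = n_plus q S & posdef_on q U].
Proof.
apply: (big_ind (fun k =>
    exists U : 'M[R]_(n + n), [/\ (U <= S)%MS, \rank U = k & posdef_on q U])).
- exists 0; split; rewrite ?sub0mx ?mxrank0// => u.
  by rewrite submx0 => /eqP->; rewrite eqxx.
- by move=> j k Uj Uk; rewrite /maxn; case: ifP.
- by move=> k /asboolP[U [US [rU pU]]]; exists U.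
Qed.

Lemma n_plus_ge q S U :
  (U <= S)%MS -> posdef_on q U -> (\rank U <= n_plus q S)%N.
Proof.
move=> US pU; have rU : (\rank U < (n + n).+1)%N by rewrite ltnS rank_leq_row.
apply: (@leq_bigmax_cond _ (fun k : 'I_(n + n).+1 => `[< _ >])
  (fun k => val k) (Ordinal rU)).
by apply/asboolP; exists U.
Qed.

Lemma n_plus_eq0 q S :
  (forall u : 'rV_(n + n), (u <= S)%MS -> q u <= 0) -> n_plus q S = 0%N.
Proof.
move=> q_le0; have [U [US <- pU]] := n_plus_witness q S.
apply/eqP; rewrite mxrank_eq0; apply/rowV0P => u uU; apply/eqP; apply: contraT.
by move=> /(pU _ uU); rewrite ltNge q_le0// (submx_trans uU).
Qed.

Lemma size_le_n_minus_sum (I : eqType) (s : seq I)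
    (q : I -> 'rV[R]_(n + n) -> R) (S : I -> 'M[R]_(n + n)) :
    {in s, forall i, posdef_on (fun v => - q i v) (S i) /\ S i != 0} ->
  (size s <= \sum_(i <- s) n_minus (q i) (S i))%N.
Proof.
move=> q_neg; rewrite -sum1_size big_seq [leqRHS]big_seq; apply: leq_sum => i.
move=> /q_neg[q_i Si0]; apply: leq_trans (n_plus_ge (submx_refl _) q_i).
by rewrite lt0n mxrank_eq0.
Qed.

End Inertia.

(** * Properties of the Maslov index *)

Lemma finite_enum_bounded (T : choiceType) (A : set T) N :
    (forall s : seq T, uniq s -> (forall x, x \in s -> A x) ->
       (size s <= N)%N) ->
  exists2 s : seq T, uniq s & forall x, x \in s <-> A x.
Proof.
move=> A_le; have /finite_seqP[s AE] : finite_set A.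
  apply: contrapT => /(infinite_set_fset N.+1)[B BA].
  by rewrite leqNgt ltnS A_le ?fset_uniq// => x /BA.
by exists (undup s) => [|x]; [exact: undup_uniq|rewrite mem_undup AE].
Qed.

Lemma within_continuous_within_comp (T U V : topologicalType)
    (A : set T) (B : set U) (f : T -> U) (g : U -> V) :
    (forall x, A x -> B (f x)) -> {within A, continuous f} ->
    {within B, continuous g} -> {within A, continuous (g \o f)}.
Proof.
move=> AB /subspace_continuousP cf /subspace_continuousP cg.
apply/subspace_continuousP => x Ax.
apply: cvg_comp (cg _ (AB _ Ax)) => S BS.
have fS : within A (nbhs x) (f @^-1` (fun y => B y -> S y)) := cf x Ax _ BS.
suff : within A (nbhs x) (f @^-1` S) by [].
by apply: filterS2 fS (withinT A (nbhs_filter x)) => z BSz /AB/BSz.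
Qed.

Definition strip (R : realType) (a b : R) : set (R * R) :=
  [set p | 0 <= p.1 <= 1 /\ a <= p.2 <= b].

Section LagrangianPaths.
Variables (R : realType) (n : nat) (Om : 'M[R]_(n + n)).
Implicit Types (l : R -> 'M[R]_(n + n)) (H : R -> R -> 'M[R]_(n + n)).

Definition lag_homotopy H (a b : R) : Prop :=
  (forall s t, 0 <= s <= 1 -> a <= t <= b -> lagr Om (H s t)) /\
  {within strip a b, continuous (fun p : R * R => H p.1 p.2)}.

Lemma lag_path_subitv l a b c d :
  a <= c -> d <= b -> lag_path Om l a b -> lag_path Om l c d.
Proof.
move=> ac db [lag_l cont_l].
have sub t : c <= t <= d -> a <= t <= b.
  by move=> /andP[ct td]; rewrite (le_trans ac ct) (le_trans td db).
by split=> [t /sub/lag_l//|]; apply: continuous_subspaceW cont_l => t /sub.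
Qed.

Lemma eq_lag_path l l' a b :
  (forall t, a <= t <= b -> l t = l' t) -> lag_path Om l a b ->
  lag_path Om l' a b.
Proof.
move=> ll' [lag_l cont_l]; split=> [t tab|].
  by rewrite -ll'//; exact: lag_l.
by apply: subspace_eq_continuous cont_l => t; rewrite inE => /ll'.
Qed.

Lemma lag_homotopy_path H a b s :
  0 <= s <= 1 -> lag_homotopy H a b -> lag_path Om (H s) a b.
Proof.
move=> s01 [lag_H cont_H]; split=> [t|]; first exact: lag_H.
have cont_pair : {within [set t | a <= t <= b], continuous (pair s)}.
  apply: continuous_subspaceT => t.
  apply: (@cvg_pair _ _ _ (nbhs t) (nbhs s) (nbhs t) _ _ _ (fun=> s) id).
    exact: cvg_cst.
  exact: cvg_id.
by apply: (within_continuous_within_comp _ cont_pair cont_H).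
Qed.

Lemma lag_path_row_proj (X : R -> 'M[R]_(n, n + n)) a b :
    (forall t, a <= t <= b -> lag_frame Om (X t)) ->
    {within [set t | a <= t <= b], continuous X} ->
  lag_path Om (fun t => row_proj (X t)) a b.
Proof.
move=> fX /subspace_continuousP cX.
split=> [t tab|]; first exact/lag_frame_lagr/fX.
apply/subspace_continuousP => t tab.
by apply: cvg_row_proj (cX t tab); exact: (fX t tab).1.
Qed.

Lemma lag_homotopy_row_proj (X : R -> R -> 'M[R]_(n, n + n)) a b :
    (forall s t, 0 <= s <= 1 -> a <= t <= b -> lag_frame Om (X s t)) ->
    {within strip a b, continuous (fun p : R * R => X p.1 p.2)} ->
  lag_homotopy (fun s t => row_proj (X s t)) a b.
Proof.
move=> fX /subspace_continuousP cX.
split=> [s t s01 tab|]; first exact/lag_frame_lagr/fX.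
apply/subspace_continuousP => p [p1 p2].
by apply: cvg_row_proj (cX p _) => //; exact: (fX _ _ p1 p2).1.
Qed.

End LagrangianPaths.

Section Index.
Variables (R : realType) (n : nat) (Om : 'M[R]_(n + n)).
Variable iota : 'M[R]_(n + n) -> (R -> 'M[R]_(n + n)) -> R -> R -> int.
Hypothesis CLM : is_CLM Om iota.
Variable L0 : 'M[R]_(n + n).
Hypothesis L0_lagr : lagr Om L0.
Implicit Types (l : R -> 'M[R]_(n + n)) (H : R -> R -> 'M[R]_(n + n)).

Lemma iota_homotopy H a b : a <= b -> lag_homotopy Om H a b ->
    (forall s, 0 <= s <= 1 -> H s a = H 0 a /\ H s b = H 0 b) ->
  iota L0 (H 0) a b = iota L0 (H 1) a b.
Proof.
move=> ab hH H_ends; have [lag_H cont_H] := hH; have [homotopy _] := CLM.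
apply: (homotopy L0 _ _ H) => //; apply: lag_homotopy_path hH.
  by rewrite lexx ler01.
by rewrite lexx ler01.
Qed.

Lemma eq_iota l l' a b : a <= b -> lag_path Om l a b ->
  (forall t, a <= t <= b -> l t = l' t) -> iota L0 l a b = iota L0 l' a b.
Proof.
move=> ab l_path ll'; have [homotopy _] := CLM; have [lag_l cont_l] := l_path.
apply: (homotopy L0 l l' (fun=> l)) => //; first exact: eq_lag_path l_path.
- by move=> s t _; exact: lag_l.
- have cont_snd : {within strip a b, continuous (@snd R R)}.
    by apply: continuous_subspaceT => p; exact: cvg_snd.
  by apply: (within_continuous_within_comp _ cont_snd cont_l) => p [].
- by move=> t /ll'.
Qed.

Lemma iota_cat l a b c d : a <= b -> b <= c -> c <= d -> lag_path Om l a d ->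
  iota L0 l a d = iota L0 l a b + iota L0 l b c + iota L0 l c d.
Proof.
move=> ab bc cd l_path; have [_ [additive _]] := CLM.
rewrite (additive L0 l a c d)// ?(le_trans ab bc)//; congr (_ + _).
by apply: additive => //; exact: lag_path_subitv l_path.
Qed.

(* Each interior crossing adds at least one to the sum of negative indices, so
   there are only finitely many of them, as the crossing formula requires. *)
Lemma iota_regular_negative l (W : R -> 'M[R]_(n + n)) a b (k N : nat) :
    let Gamma t := crossing_form Om l t (W t) in
    let S t := (l t :&: L0)%MS in
    a < b -> (forall t, lagr Om (l t)) -> contdiff l ->
    (forall t, lagr Om (W t) /\ (W t :&: l t == (0 : 'M[R]_(n + n)))%MS) ->
    (forall t, a <= t <= b -> nondeg_on (Gamma t) (S t)) ->
    (forall t, a <= t < b -> posdef_on (fun v => - Gamma t v) (S t)) ->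
    (forall s : seq R, uniq s -> {in s, forall t, a < t <= b} ->
       (\sum_(t <- s) n_minus (Gamma t) (S t) + k <= N)%N) ->
  k%:Z - N%:Z <= iota L0 l a b <= 0.
Proof.
move=> Gamma S ab lag_l l_C1 W_lagr nondeg neg n_minus_le.
have n_plus0 t : a <= t < b -> n_plus (Gamma t) (S t) = 0%N.
  move=> /neg neg_t; apply: n_plus_eq0 => u uS.
  have [->|u0] := eqVneq u 0; first by rewrite /Gamma crossing_form0.
  by rewrite -oppr_ge0 ltW// neg_t.
have [s s_uniq sE] : exists2 s : seq R, uniq s &
    forall t, t \in s <-> a < t < b /\ crossing L0 l t.
  apply: (finite_enum_bounded (N := N)) => s s_uniq s_crossing.
  have s_itv : {in s, forall t, a < t <= b}.
    by move=> t /s_crossing[/andP[-> /ltW->]].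
  apply: leq_trans (n_minus_le s s_uniq s_itv).
  apply: leq_trans (leq_addr _ _); apply: size_le_n_minus_sum => t.
  by move=> /s_crossing[/andP[/ltW a_t t_b] St0]; split=> //; apply/neg/andP.
have [dl cdl] := contdiff_derive l_C1; have [_ [_ regular]] := CLM.
rewrite (regular L0 l W a b s)// -/Gamma ?n_plus0 ?lexx//; last first.
  by move=> t tab _; exact: nondeg.
have -> : \sum_(t <- s) sgn_form (Gamma t) (S t) =
    - (\sum_(t <- s) n_minus (Gamma t) (S t))%N%:Z.
  rewrite (big_morph Posz (id1 := 0) (op1 := +%R)) // -sumrN.
  rewrite big_seq [RHS]big_seq; apply: eq_bigr => t /sE[/andP[a_t t_b] _].
  by rewrite /sgn_form n_plus0 ?sub0r// ltW.
have b_s : b \notin s by apply/negP => /sE[]; rewrite ltxx andbF.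
have := n_minus_le (b :: s); rewrite /= b_s s_uniq big_cons => /(_ isT).
have bs_itv : {in b :: s, forall t, a < t <= b}.
  move=> t; rewrite inE => /predU1P[->|]; first by rewrite ab lexx.
  by move=> /sE[/andP[-> /ltW->]].
move=> /(_ bs_itv); rewrite -/(Gamma b) -/(S b); lia.
Qed.

End Index.

(** * The index of a pencil *)

Section BentIndex.
Variables (R : realType) (n r : nat) (Om : 'M[R]_(n + n)).
Hypothesis Om_sympl : sympl_form Om.
Variables (X Y : 'M[R]_(n, n + n)) (D : 'M[R]_n).
Hypothesis aXY : adapted Om X Y D.
Variable L0 : 'M[R]_(n + n).
Hypothesis L0_lagr : lagr Om L0.
Variables (E G : 'M[R]_(r, n + n)).
Hypotheses (eqE : (E :=: X :&: Y :&: L0)%MS) (EG : gram Om E G = 1%:M).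
Hypothesis G0 : gram Om G G = 0.
Variable a : R.
Variable W : R -> 'M[R]_(n + n).

Local Notation bent := (bent_pencil Om X Y G).
Local Notation bent_form := (bent_form Om X Y D G).
Local Notation l := (fun t => row_proj (bent (t - a))).
Local Notation Gamma t := (crossing_form Om l t (W t)).

Hypothesis W_lagr :
  forall t, lagr Om (W t) /\ (W t :&: l t == (0 : 'M[R]_(n + n)))%MS.

Let Om_skew : Om^T = - Om. Proof. by case: Om_sympl. Qed.

Let Om_unit : Om \in unitmx. Proof. by case: Om_sympl. Qed.

Let L0_isotropic : gram Om L0 L0 = 0. Proof. exact: lagr_isotropic L0_lagr. Qed.

Let bent_frame u : lag_frame Om (bent u).
Proof. exact: bent_lag_frame aXY G0 u. Qed.

Lemma bent_crossing_coord t (v : 'rV[R]_(n + n)) : (v <= l t :&: L0)%MS ->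
  exists2 x : 'rV[R]_n, v = x *m bent (t - a) & (x *m bent (t - a) <= L0)%MS.
Proof.
rewrite sub_capmx (row_proj_eqmx (bent_frame _).1) => /andP[/submxP[x ->] xL].
by exists x.
Qed.

Lemma bent_crossing_form t (x : 'rV[R]_n) :
  Gamma t (x *m bent (t - a)) = gram (bent_form (t - a)) x x 0 0.
Proof.
have [W_t Wl_t] := W_lagr t; set u := t - a.
have cont_u : {for t, continuous (fun s => s - a)}.
  by apply: cvgB; [exact: cvg_id|exact: cvg_cst].
pose K v := bend Om X Y G v.
pose Q s := (u + (s - a) - 1) *: (K u *m (K (s - a))^T) - D.
have -> : bent_form u = Q t by rewrite /Q /K -/u; congr (_ *: _ - _); ring.
have frames s : lag_frame Om (bent (s - a)) := bent_frame _.
apply: (crossing_form_frame Om_unit (X := fun s => bent (s - a)) (Q := Q)).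
- exact: frames.
- exact: contdiff_continuous (contdiff_bent_pencil _ _ _ _ _) t.
- move=> s; rewrite (gram_bent Om_skew aXY G0) -[Q s]opprB scalerN -scaleNr.
  by congr (_ *: _); rewrite /u; ring.
- apply: cvgB; last exact: cvg_cst.
  apply: cvgZ; last apply: cvg_mulmx; first last.
  + apply: cvg_trmx; apply: cvg_gram; last exact: cvg_cst.
    exact: cvg_pencil.
  + exact: cvg_cst.
  + by apply: cvgB; [apply: cvgD => //; exact: cvg_cst|exact: cvg_cst].
- exact: W_t.
- exact: Wl_t.
Qed.

Lemma bent_crossing_form_neg t :
  a <= t < a + 1 -> posdef_on (fun v => - Gamma t v) (l t :&: L0)%MS.
Proof.
move=> /andP[a_le_t t_a1] _ /bent_crossing_coord[x -> xL] x0.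
rewrite bent_crossing_form oppr_gt0.
apply: (bent_form_lt0 Om_skew aXY L0_isotropic eqE EG _ xL).
  by rewrite subr_ge0 a_le_t ltrBlDl.
by apply: contraNneq x0 => ->; rewrite mul0mx.
Qed.

Lemma bent_crossing_form_nondegenerate t :
  a <= t <= a + 1 -> nondeg_on (Gamma t) (l t :&: L0)%MS.
Proof.
move=> /andP[a_le_t t_a1] _ /bent_crossing_coord[x -> xL] x_radical.
suff -> : x = 0 by rewrite mul0mx.
apply: (bent_form_nondegenerate Om_skew aXY L0_isotropic eqE EG _ xL).
  by rewrite subr_ge0 a_le_t lerBlDl.
move=> y yL; apply/matrixP => i j; rewrite !ord1 [RHS]mxE.
have := x_radical (y *m bent (t - a)).
rewrite sub_capmx (row_proj_eqmx (bent_frame _).1) submxMl yL => /(_ isT).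
rewrite -mulmxDl !bent_crossing_form gram_polarization; last first.
  exact: tr_bent_form.
by move/eqP; rewrite mulrn_eq0 => /eqP.
Qed.

Lemma bent_n_minus_sum (s : seq R) :
  uniq s -> {in s, forall t, a < t <= a + 1} ->
  (\sum_(t <- s) n_minus (Gamma t) (l t :&: L0)%MS
    + \rank (Y :&: X + X :&: L0)%MS <= n)%N.
Proof.
move=> s_uniq s_itv.
have [U U_wit] := choice (fun t =>
  n_plus_witness (fun v => - Gamma t v) (l t :&: L0)%MS).
pose A u := <<U (u + a)%R *m pinvmx (bent u)>>%MS.
have UB t : U t *m pinvmx (bent (t - a)) *m bent (t - a) = U t.
  have [U_l _ _] := U_wit t; rewrite mulmxKpV//.
  by rewrite -(row_proj_eqmx (bent_frame _).1) (submx_trans U_l)// capmxSl.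
have AB t : (A (t - a) *m bent (t - a) :=: U t)%MS.
  by apply: eqmx_trans (eqmxMr _ (genmxE _)) _; rewrite subrK UB.
have AL t : (A (t - a) *m bent (t - a) <= L0)%MS.
  by have [U_l _ _] := U_wit t; rewrite AB (submx_trans U_l)// capmxSr.
have s_01 t : t \in s -> 0 < t - a <= 1.
  by move=> /s_itv; rewrite subr_gt0 lerBlDl.
have := bent_crossings_rank Om_skew aXY L0_isotropic eqE EG G0
  (s := [seq t - a | t <- s]) (A := A).
rewrite map_inj_uniq// => [|t t' /addIr//]; rewrite big_map.
move=> /(_ s_uniq) A_rank; apply: leq_trans (A_rank _ _ _).
- rewrite leq_add2r; apply: leq_sum => t _.
  rewrite /n_minus; have [_ <- _] := U_wit t.
  by rewrite -(AB t) mxrankM_maxl.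
- by move=> _ /mapP[t /s_01 t01 ->].
- by move=> _ /mapP[t _ ->].
move=> _ /mapP[t ts ->].
apply: (bent_form_lt0_anisotropic Om_skew aXY L0_isotropic eqE EG _ (AL t)).
  exact: s_01.
move=> x xA x0; rewrite -bent_crossing_form -oppr_gt0.
have [_ _ U_pos] := U_wit t; apply: U_pos; first by rewrite -(AB t) submxMr.
by rewrite mulmx_free_eq0//; exact: (bent_frame _).1.
Qed.

End BentIndex.

Section PencilIndex.
Variables (R : realType) (n : nat) (Om : 'M[R]_(n + n)).
Hypothesis Om_sympl : sympl_form Om.
Variable iota : 'M[R]_(n + n) -> (R -> 'M[R]_(n + n)) -> R -> R -> int.
Hypothesis CLM : is_CLM Om iota.
Variable L0 : 'M[R]_(n + n).
Hypothesis L0_lagr : lagr Om L0.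

Let Om_skew : Om^T = - Om. Proof. by case: Om_sympl. Qed.

Let Om_unit : Om \in unitmx. Proof. by case: Om_sympl. Qed.

Lemma bent_index r X Y D (E G : 'M[R]_(r, n + n)) a :
    adapted Om X Y D -> (E :=: X :&: Y :&: L0)%MS ->
    gram Om E G = 1%:M -> gram Om G G = 0 ->
  (\rank (Y :&: X + X :&: L0)%MS)%:Z - n%:Z <=
    iota L0 (fun t => row_proj (bent_pencil Om X Y G (t - a))) a (a + 1) <= 0.
Proof.
move=> aXY eqE EG G0.
have bent_frame t := bent_lag_frame Om_skew Om_unit aXY G0 (t - a).
have [W W_lagr] := choice (fun t => lagr_transversal Om_sympl (bent_frame t)).
apply: (iota_regular_negative CLM L0_lagr (W := W)); first by rewrite ltrDl.
- by move=> t; exact: lag_frame_lagr.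
- apply: contdiff_row_proj => [t|]; first exact: (bent_frame t).1.
  exact: contdiff_bent_pencil.
- exact: W_lagr.
- exact: (bent_crossing_form_nondegenerate Om_sympl aXY L0_lagr eqE EG G0).
- exact: (bent_crossing_form_neg Om_sympl aXY L0_lagr eqE EG G0).
- exact: (bent_n_minus_sum Om_sympl aXY L0_lagr eqE EG G0).
Qed.

Lemma pencil_index X Y D a : adapted Om X Y D ->
  (\rank (Y :&: X + X :&: L0)%MS)%:Z - n%:Z <=
    iota L0 (fun t => row_proj (pencil X Y (t - a))) a (a + 1) <= 0.
Proof.
move=> aXY; pose E := row_base (X :&: Y :&: L0)%MS.
have eqE : (E :=: X :&: Y :&: L0)%MS := eq_row_base _.
have EL : (E <= L0)%MS by rewrite eqE capmxSr.
have E0 := gram_eq0S EL EL (lagr_isotropic L0_lagr).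
have two_neq0 : 2%:R != 0 :> R by rewrite pnatr_eq0.
have [G EG G0] := isotropic_dual Om_unit two_neq0 Om_skew (row_base_free _) E0.
pose q (t : R) := (t - a) ^+ 2 - (t - a).
pose H s t := pencil X Y (t - a) *m shear Om G (s * q t).
suff : iota L0 (fun t => row_proj (H 0 t)) a (a + 1) =
    iota L0 (fun t => row_proj (H 1 t)) a (a + 1).
  have -> : H 0 = (fun t => pencil X Y (t - a)).
    by apply/funext => t; rewrite /H mul0r shear0 mulmx1.
  have -> : H 1 = (fun t => bent_pencil Om X Y G (t - a)).
    by apply/funext => t; rewrite /H mul1r.
  by move=> ->; exact: bent_index aXY eqE EG G0.
apply: (iota_homotopy CLM L0_lagr (H := fun s t => row_proj (H s t))).
- by rewrite lerDl.
- apply: lag_homotopy_row_proj => [s t _ _|].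
    apply: lag_frame_isometry => //; first exact: shear_isometry.
    exact: pencil_lag_frame aXY _.
  apply: continuous_subspaceT => p.
  have cu : (p'.2 - a) @[p' --> p] --> p.2 - a.
    by apply: cvgB; [exact: cvg_snd|exact: cvg_cst].
  apply: cvg_mulmx; first exact: cvg_pencil.
  apply: cvg_shear; apply: cvgM; first exact: cvg_fst.
  by apply: cvgB => //; rewrite expr2; apply: cvgM.
- have [qa qb] : q a = 0 /\ q (a + 1) = 0.
    by rewrite /q subrr addrAC subrr; split; ring.
  by move=> s _; rewrite /H qa qb !mulr0.
Qed.

Lemma iota_cst L a : lagr Om L -> iota L0 (fun=> L) a (a + 1) = 0.
Proof.
move=> /lagr_frame[X fX ->].
have -> : (fun=> row_proj X) = (fun t => row_proj (pencil X X (t - a))).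
  by apply/funext => t; rewrite pencil_const.
have := pencil_index a (adapted_refl fX).
have : (n <= \rank (X :&: X + X :&: L0)%MS)%N.
  rewrite -[X in (X <= _)%N](eqP fX.1); apply: mxrankS.
  by apply: submx_trans (addsmxSl _ _); rewrite sub_capmx !submx_refl.
move: (\rank _) (iota _ _ _ _); lia.
Qed.

End PencilIndex.

(** * Sweeping a path across a homotopy *)

Definition clamp (R : realDomainType) (a b t : R) : R :=
  Num.max a (Num.min t b).

Section Clamp.
Variables (R : realDomainType) (a b : R).
Hypothesis ab : a <= b.

Lemma clamp_itv t : a <= clamp a b t <= b.
Proof. by rewrite /clamp le_max lexx ge_max ab ge_min lexx orbT. Qed.

Lemma clamp_le t : t <= a -> clamp a b t = a.
Proof. by move=> ta; rewrite /clamp max_l// ge_min ta. Qed.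

Lemma clamp_ge t : b <= t -> clamp a b t = b.
Proof. by move=> bt; rewrite /clamp min_r// max_r. Qed.

Lemma clamp_id t : a <= t <= b -> clamp a b t = t.
Proof. by move=> /andP[a_le_t t_le_b]; rewrite /clamp min_l// max_r. Qed.

End Clamp.

Lemma continuous_clamp (R : realType) (a b : R) : continuous (clamp a b).
Proof.
move=> t; apply: (@continuous_max R R (fun=> a) (fun s => Num.min s b)).
  exact: cvg_cst.
by apply: (@continuous_min R R id (fun=> b)); [exact: cvg_id|exact: cvg_cst].
Qed.

Section Sweep.
Variables (R : realType) (n : nat) (Om : 'M[R]_(n + n)).
Hypothesis Om_sympl : sympl_form Om.
Variable iota : 'M[R]_(n + n) -> (R -> 'M[R]_(n + n)) -> R -> R -> int.
Hypothesis CLM : is_CLM Om iota.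
Variable L0 : 'M[R]_(n + n).
Hypothesis L0_lagr : lagr Om L0.
Variables (H : R -> R -> 'M[R]_(n + n)) (a b : R).
Hypotheses (ab : a <= b) (H_lagr : lag_homotopy Om H a b).

(* [sweep 0] runs along [H 0] and then, on [b, b + 1], along the edge
   [H _ b]; [sweep 1] runs along the edge [H _ a], on [a - 1, a], and then
   along [H 1]. Both are constant on the remaining unit interval. *)
Definition sweep_param (s t : R) : R :=
  s * clamp 0 1 (t - (a - 1)) + (1 - s) * clamp 0 1 (t - b).

Definition sweep (s t : R) : 'M[R]_(n + n) := H (sweep_param s t) (clamp a b t).

Lemma sweep_param_itv s t : 0 <= s <= 1 -> 0 <= sweep_param s t <= 1.
Proof.
rewrite /sweep_param => s01.
have := clamp_itv ler01 (t - (a - 1)); have := clamp_itv ler01 (t - b).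
move: (clamp _ _ _) (clamp _ _ _) s01 => u v; nra.
Qed.

Lemma sweep_lag_homotopy c d : lag_homotopy Om sweep c d.
Proof.
have [lag_H cont_H] := H_lagr; split=> [s t s01 _|].
  by apply: lag_H; [exact: sweep_param_itv|exact: clamp_itv].
pose P (p : R * R) := (sweep_param p.1 p.2, clamp a b p.2).
have P_strip p : strip c d p -> strip a b (P p).
  by move=> [p1 _]; split; [exact: sweep_param_itv|exact: clamp_itv].
have cont_P : {within strip c d, continuous P}.
  apply: continuous_subspaceT => p.
  have clamp_cvg u v w :
      clamp u v (q.2 - w) @[q --> p] --> clamp u v (p.2 - w).
    apply: continuous_cvg; first exact: continuous_clamp.
    by apply: cvgB; [exact: cvg_snd|exact: cvg_cst].
  have param_cvg : sweep_param q.1 q.2 @[q --> p] --> sweep_param p.1 p.2.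
    apply: cvgD; apply: cvgM; try exact: clamp_cvg; first exact: cvg_fst.
    by apply: cvgB; [exact: cvg_cst|exact: cvg_fst].
  have := clamp_cvg a b 0; under eq_fun do rewrite subr0; rewrite subr0.
  exact: cvg_pair param_cvg.
exact: (within_continuous_within_comp P_strip cont_P cont_H).
Qed.

Lemma iota_sweep_cat s : 0 <= s <= 1 ->
  iota L0 (sweep s) (a - 1) (b + 1) =
  iota L0 (sweep s) (a - 1) a + iota L0 (sweep s) a b
    + iota L0 (sweep s) b (b + 1).
Proof.
move=> s01; apply: (iota_cat CLM L0_lagr); rewrite ?lerDl ?gerDl ?lerN10//.
exact: lag_homotopy_path s01 (sweep_lag_homotopy _ _).
Qed.

Lemma eq_iota_sweep s c d l : 0 <= s <= 1 -> c <= d ->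
  (forall t, c <= t <= d -> sweep s t = l t) ->
  iota L0 (sweep s) c d = iota L0 l c d.
Proof.
move=> s01 cd; apply: (eq_iota CLM L0_lagr cd).
exact: lag_homotopy_path s01 (sweep_lag_homotopy _ _).
Qed.

Lemma iota_sweep0 :
  iota L0 (sweep 0) (a - 1) (b + 1) =
  iota L0 (H 0) a b + iota L0 (fun t => H (t - b) b) b (b + 1).
Proof.
have r01 : 0 <= (0 : R) <= 1 by rewrite lexx ler01.
have [lag_H _] := H_lagr.
have param0 t : sweep_param 0 t = clamp 0 1 (t - b).
  by rewrite /sweep_param mul0r add0r subr0 mul1r.
rewrite iota_sweep_cat//.
rewrite (@eq_iota_sweep _ (a - 1) a (fun=> H 0 a)) ?gerDl ?lerN10//; last first.
  move=> t /andP[_ t_le_a]; rewrite /sweep param0 (clamp_le b t_le_a).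
  by rewrite clamp_le// subr_le0 (le_trans t_le_a).
rewrite (@eq_iota_sweep _ a b (H 0))//; last first.
  move=> t /[dup]/andP[_ t_le_b] tab; rewrite /sweep param0 (clamp_id tab).
  by rewrite clamp_le// subr_le0.
rewrite (@eq_iota_sweep _ b (b + 1) (fun t => H (t - b) b)) ?lerDl//;
  last first.
  move=> t /andP[b_le_t t_le_b1]; rewrite /sweep param0 (clamp_ge ab b_le_t).
  by rewrite clamp_id// subr_ge0 b_le_t lerBlDl.
rewrite -[X in iota L0 (fun=> H 0 a) _ X](subrK 1 a).
rewrite (iota_cst Om_sympl CLM L0_lagr) ?add0r//.
by apply: lag_H => //; rewrite lexx.
Qed.

Lemma iota_sweep1 :
  iota L0 (sweep 1) (a - 1) (b + 1) =
  iota L0 (fun t => H (t - (a - 1)) a) (a - 1) a + iota L0 (H 1) a b.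
Proof.
have r01 : 0 <= (1 : R) <= 1 by rewrite lexx ler01.
have [lag_H _] := H_lagr.
have param1 t : sweep_param 1 t = clamp 0 1 (t - (a - 1)).
  by rewrite /sweep_param subrr mul0r addr0 mul1r.
rewrite iota_sweep_cat//.
rewrite (@eq_iota_sweep _ (a - 1) a (fun t => H (t - (a - 1)) a))
  ?gerDl ?lerN10//; last first.
  move=> t /andP[a_le_t t_le_a]; rewrite /sweep param1 (clamp_le b t_le_a).
  by rewrite clamp_id// subr_ge0 a_le_t opprB addrCA gerDl subr_le0.
rewrite (@eq_iota_sweep _ a b (H 1))//; last first.
  move=> t /[dup]/andP[a_le_t _] tab; rewrite /sweep param1 (clamp_id tab).
  by rewrite clamp_ge// opprB addrCA lerDl subr_ge0.
rewrite (@eq_iota_sweep _ b (b + 1) (fun=> H 1 b)) ?lerDl//; last first.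
  move=> t /andP[b_le_t _]; rewrite /sweep param1 (clamp_ge ab b_le_t).
  by rewrite clamp_ge// opprB addrCA lerDl subr_ge0 (le_trans ab).
rewrite (iota_cst Om_sympl CLM L0_lagr) ?addr0//.
by apply: lag_H => //; rewrite lexx ab.
Qed.

Lemma iota_rectangle :
  iota L0 (H 0) a b + iota L0 (fun t => H (t - b) b) b (b + 1) =
  iota L0 (fun t => H (t - (a - 1)) a) (a - 1) a + iota L0 (H 1) a b.
Proof.
rewrite -iota_sweep0 -iota_sweep1; apply: (iota_homotopy CLM L0_lagr).
- by rewrite lerD// lerN10.
- exact: sweep_lag_homotopy.
move=> s _; rewrite /sweep /sweep_param; split.
  have le0 : a - 1 - b <= 0 by rewrite subr_le0 lerBlDr (le_trans ab)// lerDl.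
  by rewrite subrr !clamp_le ?mulr0// gerDl lerN10.
have ge1 : 1 <= b + 1 - (a - 1).
  by rewrite lerBrDr addrC subrK (le_trans ab)// lerDl.
have eq1 : b + 1 - b = 1 by rewrite addrAC subrr add0r.
rewrite eq1 (clamp_ge ler01 (lexx 1)) (clamp_ge ler01 ge1) !mulr1.
by rewrite ![_ + (1 - _)]addrC !subrK.
Qed.

End Sweep.

(** * Comparison of the two indices *)

Lemma capmx_mulr_unit (F : fieldType) m1 m2 p (A : 'M[F]_(m1, p))
    (B : 'M[F]_(m2, p)) (g : 'M[F]_p) :
  g \in unitmx -> (A *m g :&: B *m g :=: (A :&: B)%MS *m g)%MS.
Proof.
move=> ug; apply/eqmxP; rewrite capmxMr andbT.
rewrite -[X in (X <= _)%MS](mulmxKV ug) submxMr//.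
by apply: submx_trans (capmxMr _ _ _) _; rewrite !mulmxK.
Qed.

Lemma mxrank_adds_cap_mulr (F : fieldType) m1 m2 m3 p (A : 'M[F]_(m1, p))
    (B : 'M[F]_(m2, p)) (C : 'M[F]_(m3, p)) (g : 'M[F]_p) :
  g \in unitmx ->
  \rank (A *m g :&: B *m g + B *m g :&: C)%MS =
  \rank (A :&: B + B :&: C *m invmx g)%MS.
Proof.
move=> ug; rewrite -[C in LHS](mulmxKV ug).
rewrite (adds_eqmx (capmx_mulr_unit _ _ ug) (capmx_mulr_unit _ _ ug)) -addsmxMr.
by rewrite mxrankMfree// row_free_unit.
Qed.

Section Comparison.
Variables (R : realType) (n : nat) (Om : 'M[R]_(n + n)).
Hypothesis Om_sympl : sympl_form Om.
Variable iota : 'M[R]_(n + n) -> (R -> 'M[R]_(n + n)) -> R -> R -> int.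
Hypothesis CLM : is_CLM Om iota.
Variable L0 : 'M[R]_(n + n).
Hypothesis L0_lagr : lagr Om L0.
Variables (psi : R -> 'M[R]_(n + n)) (T : R).
Hypotheses (T_ge0 : 0 <= T) (psi0 : psi 0 = 1%:M).
Hypothesis psi_cont : {within [set t | 0 <= t <= T], continuous psi}.
Hypothesis psi_sympl : forall t, 0 <= t <= T -> sympl_map Om (psi t).

Let Om_skew : Om^T = - Om. Proof. by case: Om_sympl. Qed.

Let Om_unit : Om \in unitmx. Proof. by case: Om_sympl. Qed.

Lemma iota_oproj_mul (L : 'M[R]_(n + n)) (Z : 'M[R]_(n, n + n)) :
    lag_frame Om Z -> (L :=: Z)%MS ->
  iota L0 (fun t => oproj (L *m psi t)) 0 T =
  iota L0 (fun t => row_proj (Z *m psi t)) 0 T.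
Proof.
move=> fZ LZ; have fZpsi t (t0T : 0 <= t <= T) : lag_frame Om (Z *m psi t).
  by apply: lag_frame_isometry => //; exact: psi_sympl.
apply/esym/(eq_iota CLM L0_lagr T_ge0) => [|t t0T]; last first.
  by rewrite (oproj_row_proj (fZpsi t t0T).1)//; exact: eqmxMr.
apply: lag_path_row_proj => //; apply/subspace_continuousP => t t0T.
apply: cvg_mulmx; first exact: cvg_cst.
exact: (subspace_continuousP _ _).1 psi_cont t t0T.
Qed.

Variables (X Y : 'M[R]_(n, n + n)) (D : 'M[R]_n).
Hypothesis aXY : adapted Om X Y D.

Lemma swept_pencil_lag_homotopy :
  lag_homotopy Om (fun s t => row_proj (pencil X Y s *m psi t)) 0 T.
Proof.
apply: lag_homotopy_row_proj => [s t _ /psi_sympl spsi|].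
  by apply: lag_frame_isometry => //; exact: pencil_lag_frame aXY s.
have cont_snd : {within strip 0 T, continuous (@snd R R)}.
  by apply: continuous_subspaceT => p; exact: cvg_snd.
have : {within strip 0 T, continuous (psi \o snd)}.
  by apply: (within_continuous_within_comp _ cont_snd psi_cont) => p [].
move=> /subspace_continuousP cpsi; apply/subspace_continuousP => p strip_p.
apply: cvg_mulmx; last exact: cpsi.
by apply: cvg_within_filter; apply: cvg_pencil; exact: cvg_fst.
Qed.

Lemma iota_difference :
  iota L0 (fun t => row_proj (Y *m psi t)) 0 T -
  iota L0 (fun t => row_proj (X *m psi t)) 0 T =
  iota L0 (fun t => row_proj (pencil (X *m psi T) (Y *m psi T) (t - T)))
    T (T + 1) -
  iota L0 (fun t => row_proj (pencil X Y (t - (0 - 1)))) (0 - 1) 0.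
Proof.
have := iota_rectangle Om_sympl CLM L0_lagr T_ge0 swept_pencil_lag_homotopy.
under eq_fun do rewrite pencil0.
under [X in _ + iota _ X T _]eq_fun do rewrite -pencil_mulr.
under [X in _ = iota _ X _ _ + _]eq_fun do rewrite psi0 mulmx1.
under [X in _ = _ + iota _ X _ _]eq_fun do rewrite pencil1.
by do 4 move: (iota _ _ _ _) => ?; lia.
Qed.

Lemma iota_difference_bound k :
    (k <= \rank (Y :&: X + X :&: L0)%MS)%N ->
    (k <= \rank (Y *m psi T :&: X *m psi T + X *m psi T :&: L0)%MS)%N ->
  `|iota L0 (fun t => row_proj (Y *m psi t)) 0 T -
    iota L0 (fun t => row_proj (X *m psi t)) 0 T| <= n%:Z - k%:Z.
Proof.
move=> ka kb; rewrite iota_difference.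
have psiT : gram Om (psi T) (psi T) = Om.
  by apply: psi_sympl; rewrite lexx T_ge0.
have := pencil_index Om_sympl CLM L0_lagr T (adapted_isometry Om_unit aXY psiT).
have := pencil_index Om_sympl CLM L0_lagr (0 - 1) aXY.
rewrite subrK; move: ka kb; do 2 move: (\rank _) => ?.
by do 2 move: (iota _ _ _ _) => ?; lia.
Qed.

End Comparison.

Theorem theorem2p9 (R : realType) (n : nat) (Om : 'M[R]_(n + n))
  (iota : 'M[R]_(n + n) -> (R -> 'M[R]_(n + n)) -> R -> R -> int)
  (L0 L1 L2 : 'M[R]_(n + n)) (psi : R -> 'M[R]_(n + n)) (T : R) :
  sympl_form Om ->
  is_CLM Om iota ->
  lagr Om L0 -> lagr Om L1 -> lagr Om L2 ->
  0 < T ->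
  {within [set t | 0 <= t <= T], continuous psi} ->
  (forall t, 0 <= t <= T -> sympl_map Om (psi t)) ->
  psi 0 = 1%:M ->
  let l1 := fun t => oproj (L1 *m psi t) in
  let l2 := fun t => oproj (L2 *m psi t) in
  let mu0 := fun t => oproj (L0 *m invmx (psi t)) in
  let eps_a := (L1 :&: L2 + L2 :&: L0)%MS in
  let eps_b := (L1 :&: L2 + L2 :&: mu0 T)%MS in
  let k := minn (\rank eps_a) (\rank eps_b) in
  `| iota L0 l1 0 T - iota L0 l2 0 T | <= n%:Z - k%:Z.
Proof.
move=> Om_sympl CLM lL0 lL1 lL2 T0 cpsi spsi psi0; cbv zeta.
have [Om_skew Om_unit] := Om_sympl.
have [[Y0 fY0 ->] [X0 fX0 ->]] := (lagr_frame lL1, lagr_frame lL2).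
have [X [Y [D [aXY XX0 YY0]]]] := adapted_exists Om_skew Om_unit fX0 fY0.
have LX := eqmx_trans (row_proj_eqmx fX0.1) (eqmx_sym XX0).
have LY := eqmx_trans (row_proj_eqmx fY0.1) (eqmx_sym YY0).
have psiT_unit : psi T \in unitmx.
  by apply: (isometry_unitmx Om_unit); apply: spsi; rewrite lexx ltW.
have iota_frame := iota_oproj_mul Om_sympl CLM lL0 (ltW T0) cpsi spsi.
rewrite (iota_frame _ _ (adapted_target aXY) LY).
rewrite (iota_frame _ _ (adapted_source aXY) LX).
apply: (iota_difference_bound Om_sympl CLM lL0 (ltW T0) psi0 cpsi spsi aXY).
  apply: leq_trans (geq_minl _ _) _.
  by rewrite (adds_eqmx (cap_eqmx LY LX) (cap_eqmx LX (eqmx_refl L0))).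
apply: leq_trans (geq_minr _ _) _; rewrite mxrank_adds_cap_mulr//.
by rewrite (adds_eqmx (cap_eqmx LY LX) (cap_eqmx LX (oproj_eqmx _))).
Qed.
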